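(* There is a constant $c>0$ such that, for every $\varepsilon_0>0$, there are $\varepsilon\in(0,\varepsilon_0)$ and a finite set $P\subseteq\mathbb{R}^2$ such that every $\varepsilon$-net for $\mathcal{L}(P)$ has at least $\frac{c}{\varepsilon}\log\frac{1}{\varepsilon}$ points.
   Context: For a finite set $P\subseteq\mathbb{R}^2$, $\mathcal{L}(P)\coloneqq\{P\cap\ell : \ell \text{ is a line in } \mathbb{R}^2\}$, regarded as a hypergraph (a family of subsets, called edges) with vertex set $P$. For a hypergraph $\mathcal{H}$ on a finite vertex set $V$ and a real $\varepsilon>0$, an $\varepsilon$-net for $\mathcal{H}$ is a set $S\subseteq V$ that intersects every nonempty $A\in\mathcal{H}$ with $|A|\ge\varepsilon|V|$. Here $\log$ is the natural logarithm. *)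

(* Defs.v *)
From mathcomp Require Import all_boot all_order all_algebra finmap.
From mathcomp Require Import boolp classical_sets reals.

Set Implicit Arguments.
Unset Strict Implicit.
Unset Printing Implicit Defensive.

Import Order.TTheory GRing.Theory Num.Theory.
Local Open Scope ring_scope.
Local Open Scope classical_set_scope.

Definition is_line (R : realType) (l : set (R * R)) : Prop :=
  exists a b c : R,
    (a, b) <> (0, 0) /\ l = [set p | a * p.1 + b * p.2 = c].

(* A hypergraph is the set of its edges; its vertex set is passed separately
   where it matters. *)
Definition hypergraph (T : choiceType) : Type := set {fset T}.

Definition line_hypergraph (R : realType) (P : {fset R * R}) :
    hypergraph (R * R)%type :=
  [set A | exists2 l : set (R * R), is_line l & [set` A] = [set` P] `&` l].

Definition eps_net (R : realType) (T : choiceType) (V : {fset T})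
    (H : hypergraph T) (eps : R) (S : {fset T}) : Prop :=
  (S `<=` V)%fset /\
  forall A : {fset T}, H A -> A != fset0 ->
    eps * #|` V|%:R <= #|` A|%:R -> (S `&` A)%fset != fset0.

(* Main.v *)
(** Take the points [(x, y)] of a grid [r * H] and the lines [y = a x + b] with
    [a < D], [b < B]: every line has [r] points, two points lie on at most one
    line, almost every point lies on [D] lines. A random subset [P] of density
    [K / r], with [K] of order [log H], meets every line in about [K] points, so
    for [1 / eps ~ H] a net must hit all the lines, and it
    suffices that so few sets of size [t = s H], with [s] of order [log H], hit
    all lines that a union bound excludes them from [P].

    Counting the hitting [t]-tuples. A large family of [t]-tuples contains a
    subtree in which, along every branch, all but [j] coordinates range over at
    least [y0] values each (the predicate [rich]). We descend this subtree,
    choosing the free coordinates so that some line survives. Give each line not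
    hit by a free choice the weight one over the probability that it survived if
    the free choices were uniform. The total weight through a point is then a
    martingale; since lines through a point are otherwise disjoint, its increments
    are small, and it stays close to [D] at all points not yet chosen. Hence the
    [j] forced coordinates, whatever they are, cannot kill all the weight. Lines
    whose weight exceeds a threshold [W] are frozen (they keep their weight
    forever, which preserves the martingale), and an entropy bound shows that
    frozen lines carry little weight. Choosing each free coordinate so as not to
    increase a potential makes the argument deterministic. *)

Require Import Defs.
From mathcomp Require Import all_boot all_order all_algebra finmap.
From mathcomp Require Import boolp classical_sets reals sequences exp.
From mathcomp Require Import lra zify.

Set Implicit Arguments.
Unset Strict Implicit.
Unset Printing Implicit Defensive.

Import Order.TTheory GRing.Theory Num.Theory.
Local Open Scope ring_scope.

(** * Hitting tuples and branching subtrees *)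

(* [Om] holds on all branches of some subtree of depth [t] in which every node
   has either [y0] children, or a single one; the latter happens at most [j]
   times along a branch. *)
Fixpoint rich {X : finType} (y0 t j : nat) (Om : seq X -> bool) : bool :=
  if t is t'.+1 then
    (y0 <= #|[pred x | rich y0 t' j (fun s => Om (x :: s))]|)%N
    || (if j is j'.+1 then [exists x, rich y0 t' j' (fun s => Om (x :: s))]
        else false)
  else Om [::].

Lemma sum_tuple_cons {X : finType} {V : nmodType} (t : nat) (F : seq X -> V) :
  \sum_(s : t.+1.-tuple X) F s = \sum_(x : X) \sum_(s : t.-tuple X) F (x :: s).
Proof.
rewrite pair_big /= (reindex (fun p : X * t.-tuple X => [tuple of p.1 :: p.2])) //=.
exists (fun s : t.+1.-tuple X => (thead s, [tuple of behead s])).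
- by move=> [x s] _ /=; rewrite theadE; congr pair; apply: val_inj.
- by move=> s _ /=; rewrite -tuple_eta.
Qed.

(** Induction on [t]. At a node that is not rich, fewer than [y0] children are rich with the same
    [j], and none of these is rich with [j - 1]; their small number supplies the factor [lam]. The
    other children are not rich with [j]. Each group takes half of the factor [2 * #|X|]. *)
Lemma not_rich_count {R : realFieldType} {X : finType} (y0 : nat) (lam : R) (t j : nat)
    (Om : seq X -> bool) :
  y0%:R <= lam * #|X|%:R -> 0 <= lam -> ~~ rich y0 t j Om ->
  \sum_(s : t.-tuple X) (Om s)%:R <= (2 * #|X|%:R) ^+ t * lam ^+ j.+1.
Proof.
move=> hy lam0; have N0 : 0 <= #|X|%:R :> R by [].
have triv (t' : nat) (Om' : seq X -> bool) :
    \sum_(s : t'.-tuple X) (Om' s)%:R <= #|X|%:R ^+ t' :> R.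
  apply: (@le_trans _ _ (\sum_(s : t'.-tuple X) 1)).
    by apply: ler_sum => s _; case: (Om' s).
  by rewrite sumr_const card_tuple natrX.
elim: t j Om => [|t IH] j Om.
  move=> /= /negbTE h.
  rewrite (eq_bigr (fun=> 0)) ?big1 ?expr0 ?mul1r ?exprn_ge0 // => s _.
  by rewrite tuple0 /= h.
rewrite (@sum_tuple_cons _ _ _ (fun s => (Om s)%:R)) /= negb_or -ltnNge => /andP[hlt hj].
set G := [pred x | _] in hlt.
rewrite (bigID (mem G)) /=.
have IHb : \sum_(i | i \notin G) \sum_(s : t.-tuple X) (Om (i :: s))%:R
    <= #|X|%:R * ((2 * #|X|%:R) ^+ t * lam ^+ j.+1).
  apply: (@le_trans _ _ (\sum_(i | i \notin G) (2 * #|X|%:R) ^+ t * lam ^+ j.+1)).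
    by apply: ler_sum => x hx; apply: (IH j (fun s => Om (x :: s))); rewrite inE in hx.
  rewrite sumr_const -[leLHS]mulr_natl ler_wpM2r ?mulr_ge0 ?exprn_ge0 ?mulr_ge0 //.
  by rewrite ler_nat max_card.
have p2 : 1 <= 2 ^+ t :> R by rewrite exprn_ege1 // ler1n.
have IHa : \sum_(i in G) \sum_(s : t.-tuple X) (Om (i :: s))%:R
    <= lam * #|X|%:R * ((2 * #|X|%:R) ^+ t * lam ^+ j).
  apply: (@le_trans _ _ (\sum_(i in G) (2 * #|X|%:R) ^+ t * lam ^+ j)).
    apply: ler_sum => x hx; case: j hj {IHb hlt hx G} => [_|j hj].
      rewrite mulr1; apply: (le_trans (triv _ (fun s => Om (x :: s)))).
      by rewrite exprMn ler_peMl // exprn_ge0.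
    apply: (IH j (fun s => Om (x :: s))); apply: contra hj => h; apply/existsP; by exists x.
  rewrite sumr_const -[leLHS]mulr_natl ler_wpM2r ?mulr_ge0 ?exprn_ge0 ?mulr_ge0 //.
  by apply: le_trans hy; rewrite ler_nat ltnW.
apply: (le_trans (lerD IHa IHb)).
rewrite !exprS; set A := (_ ^+ t); set B := _ ^+ j; lra.
Qed.

(** * One step of the weighted process *)

Section Step.
Variables (R : realType) (X L : finType) (inc : X -> L -> bool) (W : R).
Hypothesis W0 : 0 < W.
Hypothesis linear : forall x y l l', x != y -> inc x l -> inc y l ->
  inc x l' -> inc y l' -> l = l'.

(* Weight [0] marks a line hit by a free choice, a weight above [W] a frozen one. *)
Definition alive (w : L -> R) (l : L) : bool := (0 < w l) && (w l <= W).

Definition aw (w : L -> R) (l : L) : R := if alive w l then w l else 0.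

Definition load (w : L -> R) (z : X) : R := \sum_(l | inc z l) w l.

Definition hits (Y : {set X}) (l : L) : R := \sum_(x in Y) (inc x l)%:R.

Definition rho (Y : {set X}) (l : L) : R := hits Y l / #|Y|%:R.

(* A uniform [x] in [Y] misses [l] with probability [1 - rho Y l], so the mean of
   the new weight is the old one. *)
Definition upd (w : L -> R) (Y : {set X}) (x : X) (l : L) : R :=
  w l + aw w l * ((~~ inc x l)%:R / (1 - rho Y l) - 1).

(* The sum avoids the points already chosen: all alive lines through them are
   hit, so their load is far below [D]. *)
Definition energy (D : R) (w : L -> R) (A : {set X}) : R :=
  \sum_(z in A) (load w z - D) ^+ 2.

Definition entropy (w : L -> R) : R := \sum_l w l * ln (w l).

Lemma aw_ge0 w l : 0 <= aw w l.
Proof. by rewrite /aw; case: ifP => // /andP[/ltW]. Qed.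

Lemma aw_le w l : aw w l <= W.
Proof. by rewrite /aw; case: ifP => [/andP[]//|_]; apply: ltW. Qed.

Lemma hits_ge0 Y l : 0 <= hits Y l.
Proof. by apply: sumr_ge0. Qed.

Lemma rho_ge0 Y l : 0 <= rho Y l.
Proof. by rewrite divr_ge0 ?hits_ge0. Qed.

Variables (w : L -> R) (Y : {set X}).
Hypothesis Y0 : (0 < #|Y|)%N.
Hypothesis rho_half : forall l, rho Y l <= 1 / 2.

Let n : R := #|Y|%:R.
Let n0 : 0 < n. Proof. by rewrite ltr0n. Qed.

Let hitsE l : hits Y l = n * rho Y l.
Proof. by rewrite /rho mulrCA divff ?mulr1 // gt_eqF. Qed.

Let mean_survival l :
  \sum_(x in Y) (~~ inc x l)%:R = n * (1 - rho Y l) :> R.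
Proof.
rewrite mulrBr -hitsE mulr1 /hits /n -sumr_const -sumrB.
by apply: eq_bigr => x _; case: (inc x l); rewrite ?subrr ?subr0.
Qed.

Let onem_rho l : 1 / 2 <= 1 - rho Y l.
Proof. have := rho_half l; lra. Qed.

Let onem_rho_neq0 l : 1 - rho Y l != 0.
Proof. by rewrite gt_eqF //; have := onem_rho l; lra. Qed.

Let inv_onem_rho l : 1 <= (1 - rho Y l)^-1 <= 2.
Proof.
have h := onem_rho l; have h1 := rho_ge0 Y l.
have p : 0 < 1 - rho Y l by lra.
apply/andP; split; first by rewrite invf_ge1 //; lra.
by rewrite -[leRHS]invrK lef_pV2 ?posrE ?invr_gt0 //; lra.
Qed.

(** The martingale property: [1 - rho Y l] is the fraction of [Y] that misses [l], so losses and
    gains cancel. *)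
Lemma sum_upd_factor l :
  \sum_(x in Y) ((~~ inc x l)%:R / (1 - rho Y l) - 1) = 0 :> R.
Proof.
by rewrite sumrB -mulr_suml mean_survival mulfK // sumr_const subrr.
Qed.

Lemma upd_dead x l : ~~ alive w l -> upd w Y x l = w l.
Proof. by rewrite /upd /aw => /negbTE ->; rewrite mul0r addr0. Qed.

Lemma upd_hit x l : alive w l -> inc x l -> upd w Y x l = 0.
Proof. by rewrite /upd /aw => -> -> /=; rewrite mul0r sub0r mulrN1 subrr. Qed.

Lemma upd_miss x l : alive w l -> ~~ inc x l -> upd w Y x l = w l / (1 - rho Y l).
Proof.
by rewrite /upd /aw => -> -> /=; rewrite mulrBr mulr1 addrC subrK mul1r.
Qed.

Let dlt (x z : X) : R :=
  \sum_(l | inc z l) aw w l * ((~~ inc x l)%:R / (1 - rho Y l) - 1).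

Let load_upd x z : load (upd w Y x) z = load w z + dlt x z.
Proof. by rewrite /load /dlt -big_split. Qed.

Let sum_dlt z : \sum_(x in Y) dlt x z = 0.
Proof.
rewrite exchange_big /= big1 // => l _.
by rewrite -mulr_sumr sum_upd_factor mulr0.
Qed.

Let dlt_self z : dlt z z = - load (aw w) z.
Proof.
rewrite /dlt /load -sumrN; apply: eq_bigr => l ->.
by rewrite /= mul0r sub0r mulrN1.
Qed.

Let Rz (z : X) : R := \sum_(l | inc z l) aw w l * rho Y l.

Let Rz_ge0 z : 0 <= Rz z.
Proof. by apply: sumr_ge0 => l _; rewrite mulr_ge0 ?aw_ge0 ?rho_ge0. Qed.

Let pw (x z : X) : R := \sum_(l | inc z l && inc x l) aw w l.

Let pw_ge0 x z : 0 <= pw x z.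
Proof. by apply: sumr_ge0 => l _; rewrite aw_ge0. Qed.

(** By [linear] the sum has at most one term. *)
Lemma sum_common (F : L -> R) (M : R) x z : x != z -> 0 <= M ->
  (forall l, F l <= M) -> \sum_(l | inc z l && inc x l) F l <= M.
Proof.
move=> xz M0 FM; case: (pickP (fun l => inc z l && inc x l)) => [l0 /andP[h1 h2]|h].
  rewrite (bigD1 l0) ?h1 //= big1 ?addr0 // => l /andP[/andP[h3 h4]].
  by rewrite (linear xz h4 h3 h2 h1) eqxx.
by rewrite big_pred0.
Qed.

(** The increment is a growth [g] on the alive lines through [z] minus a loss [h] on the at most one
    line shared with [x]. Both are nonnegative, so the square is at most [g ^+ 2 + h ^+ 2];
    [pw x z <= W] makes the loss term linear. *)
Let dlt_sq x z : x != z -> dlt x z ^+ 2 <= 4 * Rz z ^+ 2 + 4 * W * pw x z.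
Proof.
move=> xz.
pose g := \sum_(l | inc z l) aw w l * rho Y l / (1 - rho Y l).
pose h := \sum_(l | inc z l && inc x l) aw w l / (1 - rho Y l).
have dE : dlt x z = g - h.
  rewrite /dlt /g /h big_mkcondr /= -sumrB; apply: eq_bigr => l _.
  have hu : rho Y l / (1 - rho Y l) = (1 - rho Y l)^-1 - 1.
    by apply: (mulIf (onem_rho_neq0 l)); rewrite divfK // mulrBl mulVf //; lra.
  rewrite -[in RHS]mulrA hu; move: (_^-1) => v; case: (inc x l) => /=; lra.
have g0 : 0 <= g.
  apply: sumr_ge0 => l _; have /andP[h1 h2] := inv_onem_rho l.
  by apply: mulr_ge0; rewrite ?(le_trans ler01 h1) // mulr_ge0 ?aw_ge0 ?rho_ge0.
have h0 : 0 <= h.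
  apply: sumr_ge0 => l _; have /andP[h1 h2] := inv_onem_rho l.
  by rewrite mulr_ge0 ?aw_ge0 // (le_trans ler01 h1).
have gR : g <= 2 * Rz z.
  rewrite /Rz mulr_sumr; apply: ler_sum => l _; rewrite [leRHS]mulrC.
  have /andP[h1 h2] := inv_onem_rho l.
  by rewrite ler_wpM2l // mulr_ge0 ?aw_ge0 ?rho_ge0.
have hp : h <= 2 * pw x z.
  rewrite /pw mulr_sumr; apply: ler_sum => l _; rewrite [leRHS]mulrC.
  have /andP[h1 h2] := inv_onem_rho l.
  by rewrite ler_wpM2l // aw_ge0.
have pW : pw x z <= W by apply: sum_common => // [|l]; [exact: ltW|exact: aw_le].
have := pw_ge0 x z; have := Rz_ge0 z; rewrite dE.
move: (pw x z) (Rz z) hp gR pW => p q; nra.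
Qed.

Lemma sum_hits_le (d : R) z : (\sum_(l | inc z l) 1 <= d) -> d <= n ->
  \sum_(l | inc z l) hits Y l <= 2 * n.
Proof.
move=> hd dn; rewrite exchange_big /=.
apply: (@le_trans _ _ (\sum_(x in Y) (1 + (x == z)%:R * d))).
  apply: ler_sum => x _; have [->|xz] := eqVneq x z.
    rewrite mul1r (eq_bigr (fun=> 1)); first lra.
    by move=> l ->.
  rewrite mul0r addr0 (eq_bigr (fun l => if inc x l then 1 else 0)); last first.
    by move=> l _; case: (inc x l).
  by rewrite -big_mkcondr; apply: sum_common.
rewrite big_split /= sumr_const -/n -mulr_suml.
have : \sum_(x in Y) (x == z)%:R <= 1 :> R.
  rewrite (eq_bigr (fun x => if x == z then 1 else 0)); last by move=> x _; case: eqP.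
  rewrite -big_mkcondr /=; case: (boolP (z \in Y)) => hz.
    rewrite (bigD1 z) ?hz ?eqxx //= big1 ?addr0 // => x /andP[/andP[_ h]].
    by rewrite h.
  by rewrite big1 // => x /andP[hx /eqP e]; rewrite -e hx in hz.
have d0 : 0 <= d by apply: le_trans hd; apply: sumr_ge0.
by nra.
Qed.

Let Rz_sum z : n * Rz z = \sum_(x in Y) pw x z.
Proof.
rewrite /Rz mulr_sumr /pw.
rewrite (eq_bigr (fun x => \sum_(l | inc z l) aw w l * (inc x l)%:R)); last first.
  move=> x _; rewrite big_mkcondr; apply: eq_bigr => l _.
  by case: (inc x l); rewrite ?mulr1 ?mulr0.
rewrite exchange_big; apply: eq_bigr => l _.
by rewrite -mulr_sumr mulrCA -hitsE.
Qed.

Let sum_dlt_sq (d : R) z : (\sum_(l | inc z l) 1 <= d) -> d <= n ->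
  \sum_(x in Y | x != z) dlt x z ^+ 2 <= 12 * W * (n * Rz z).
Proof.
move=> hd dn; apply: (@le_trans _ _ (\sum_(x in Y) (4 * Rz z ^+ 2 + 4 * W * pw x z))).
  rewrite big_mkcondr; apply: ler_sum => x _; case: ifP => [/dlt_sq//|_].
  by rewrite addr_ge0 ?mulr_ge0 ?sqr_ge0 ?pw_ge0 // ltW.
rewrite big_split /= sumr_const -mulr_sumr -Rz_sum -[_ *+ _]mulr_natl -/n.
(* This turns [4 * Rz z ^+ 2] into [8 * W * Rz z], whence the constant 12. *)
have : Rz z <= 2 * W.
  rewrite -(ler_pM2l n0); have := ler_wpM2l (ltW W0) (sum_hits_le hd dn).
  have : n * Rz z <= W * \sum_(l | inc z l) hits Y l.
    rewrite !mulr_sumr; apply: ler_sum => l _; rewrite mulrCA -hitsE.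
    by rewrite ler_wpM2r ?hits_ge0 ?aw_le.
  lra.
have := Rz_ge0 z; move: (Rz z) => q q0 qW.
have nq0 : 0 <= n * q by rewrite mulr_ge0 // ltW.
have qW0 : 0 <= 2 * W - q by lra.
have := mulr_ge0 nq0 qW0; lra.
Qed.

Variables (r : nat) (A : {set X}) (D : R).
Hypothesis D0 : 0 < D.
Hypothesis card_line : forall l, \sum_(z | inc z l) 1 = r%:R :> R.
Hypothesis degree_le : forall z, \sum_(l | inc z l) 1 <= D.
Hypothesis Dn : D <= n.
Hypothesis w_cases : forall l, w l = 0 \/ 1 <= w l.
Hypothesis alive_in : forall z l, alive w l -> inc z l -> z \in A.

Let total : R := \sum_(x in Y) load (aw w) x.

Let sum_Rz : \sum_z n * Rz z = r%:R * total.
Proof.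
rewrite (eq_bigr _ (fun z _ => Rz_sum z)) exchange_big /= mulr_sumr.
apply: eq_bigr => x _; rewrite /pw /load.
rewrite (exchange_big_dep (inc x)) /=; last by move=> z l _ /andP[].
rewrite mulr_sumr; apply: eq_bigr => l hl.
rewrite -(card_line l) mulr_suml [RHS]big_mkcond [LHS]big_mkcond /=.
by apply: eq_bigr => z _; rewrite hl andbT; case: ifP; rewrite ?mul1r.
Qed.

(** After expanding the square, the linear term would vanish by the martingale property if [x]
    ranged over all of [Y]. As [z] leaves the set when [x = z], the missing [dlt z z] leaves a cross
    term. The last summand bounds the variance. *)
Lemma energy_upd_sum :
  \sum_(x in Y) energy D (upd w Y x) (A :\ x) <=
  n * energy D w A + 2 * \sum_(z in A :&: Y) (load w z - D) * load (aw w) z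
  + 12 * W * r%:R * total.
Proof.
have -> : \sum_(x in Y) energy D (upd w Y x) (A :\ x) =
    \sum_(z in A) \sum_(x in Y | x != z) (load w z - D + dlt x z) ^+ 2.
  rewrite (eq_bigr (fun x => \sum_(z in A) if x != z then (load w z - D + dlt x z) ^+ 2 else 0)).
    rewrite exchange_big /=; apply: eq_bigr => z _.
    by rewrite -big_mkcondr.
  move=> x _; rewrite /energy -big_mkcondr; apply: eq_big => z.
    by rewrite !inE eq_sym andbC.
  by rewrite load_upd addrAC.
have key z : \sum_(x in Y | x != z) (load w z - D + dlt x z) ^+ 2 <=
    n * (load w z - D) ^+ 2
    + (if z \in Y then 2 * ((load w z - D) * load (aw w) z) else 0)
    + 12 * W * (n * Rz z).
  set a := load w z - D.
  have s1 : \sum_(x in Y | x != z) a ^+ 2 <= n * a ^+ 2.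
    rewrite mulr_natl -sumr_const big_mkcondr; apply: ler_sum => x _.
    by case: ifP => _; rewrite ?sqr_ge0.
  have s2 : \sum_(x in Y | x != z) dlt x z = if z \in Y then load (aw w) z else 0.
    case: ifP => hz.
      by have := sum_dlt z; rewrite (bigD1 z) //= dlt_self; move/eqP; rewrite addrC subr_eq0 => /eqP.
    rewrite -[RHS](sum_dlt z); apply: eq_bigl => x; case: eqP => [->|]; rewrite ?hz ?andbT //.
  have s3 := sum_dlt_sq (degree_le z) Dn.
  rewrite (eq_bigr (fun x => a ^+ 2 + 2 * a * dlt x z + dlt x z ^+ 2)); last first.
    by move=> x _; lra.
  rewrite !big_split /= -[X in _ + X + _]mulr_sumr s2.
  by apply: lerD => //; apply: lerD => //; case: ifP => _; lra.
apply: le_trans; first by apply: ler_sum => z _; exact: key.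
rewrite !big_split /= -[X in X + _ + _]mulr_sumr -[X in _ + _ + X]mulr_sumr.
apply: lerD; first apply: lerD => //.
  rewrite -big_mkcondr mulr_sumr le_eqVlt; apply/orP; left.
  by apply/eqP; apply: eq_bigl => z; rewrite !inE.
rewrite -(mulrA _ r%:R) -sum_Rz; apply: ler_wpM2l; first by rewrite mulr_ge0 // ltW.
rewrite big_mkcond; apply: ler_sum => z _; case: ifP => _ //.
by rewrite mulr_ge0 ?Rz_ge0 // ltW.
Qed.

Lemma load_aw_ge0 z : 0 <= load (aw w) z.
Proof. by apply: sumr_ge0 => l _; rewrite aw_ge0. Qed.

Lemma load_aw_le z : load (aw w) z <= load w z.
Proof.
apply: ler_sum => l _; rewrite /aw; case: ifP => // _.
by have [->//|] := w_cases l; apply: le_trans.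
Qed.

Lemma load_aw_out z : z \notin A -> load (aw w) z = 0.
Proof.
move=> hz; apply: big1 => l hl; rewrite /aw; case: ifP => // ha.
by rewrite (alive_in ha hl) in hz.
Qed.

Lemma energy_sub_le : \sum_(z in A :&: Y) (load w z - D) ^+ 2 <= energy D w A.
Proof.
rewrite /energy [leRHS](big_setID Y) /= lerDl.
by apply: sumr_ge0 => z _; rewrite sqr_ge0.
Qed.

Let total_AY : total = \sum_(z in A :&: Y) load (aw w) z.
Proof.
rewrite /total (bigID (mem A)) /= [X in _ + X]big1 ?addr0.
  by apply: eq_bigl => z; rewrite !inE andbC.
by move=> z /andP[_ hz]; rewrite load_aw_out.
Qed.

Let card_AY : \sum_(z in A :&: Y) 1 <= n :> R.
Proof. by rewrite sumr_const ler_nat subset_leq_card // subsetIr. Qed.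

Let total_le : total * D <= 2 * D ^+ 2 * n + energy D w A.
Proof.
apply: le_trans (lerD (ler_wpM2l _ card_AY) energy_sub_le); last first.
  by rewrite mulr_ge0 // sqr_ge0.
rewrite total_AY mulr_suml mulr_sumr -big_split /=; apply: ler_sum => z _.
have := load_aw_le z; have := load_aw_ge0 z.
move: (load (aw w) z) (load w z) => a b a0 ab.
have : a * D <= b * D by rewrite ler_pM2r.
have := sqr_ge0 (b - D - D / 2); have := sqr_ge0 D; lra.
Qed.

(** Only points with load above [D] matter; there the alive load is at most the load, and AM-GM
    weighted by [g] splits [2 * (b - D) * D]. *)
Let cross_le (g : R) : 0 < g ->
  2 * (\sum_(z in A :&: Y) (load w z - D) * load (aw w) z) <=
  2 * g * D ^+ 2 * n + (1 / (2 * g) + 2) * energy D w A.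
Proof.
move=> g0.
have h0 : 0 <= 1 / (2 * g) + 2 by rewrite addr_ge0 // divr_ge0 // mulr_ge0 // ltW.
apply: le_trans (lerD (ler_wpM2l _ card_AY) (ler_wpM2l h0 energy_sub_le)); last first.
  by rewrite !mulr_ge0 ?sqr_ge0 // ltW.
rewrite !mulr_sumr -big_split /=; apply: ler_sum => z _.
have := load_aw_le z; have := load_aw_ge0 z.
move: (load (aw w) z) (load w z) => a b a0 ab.
have hg : 1 / (2 * g) * (2 * g) = 1 by rewrite divfK // mulf_neq0 // gt_eqF.
have hv0 : 0 < 1 / (2 * g) by rewrite divr_gt0 // mulr_gt0.
move: (1 / (2 * g)) hg hv0 h0 => v hg hv0 h0; rewrite mulr1.
case: (lerP (b - D) 0) => hb.
  have : (b - D) * a <= 0 by rewrite mulr_le0_ge0.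
  have : 0 <= (v + 2) * (b - D) ^+ 2 by rewrite mulr_ge0 ?sqr_ge0.
  have : 0 <= g * D ^+ 2 by rewrite mulr_ge0 ?sqr_ge0 // ltW.
  lra.
have h1 : (b - D) * a <= (b - D) * b by rewrite ler_pM2l.
have h2 : 0 <= v * ((b - D) - 2 * g * D) ^+ 2 by rewrite mulr_ge0 ?sqr_ge0 // ltW.
have h3 : v * ((b - D) - 2 * g * D) ^+ 2 =
    v * (b - D) ^+ 2 - 2 * (b - D) * D * (v * (2 * g)) + 2 * g * D ^+ 2 * (v * (2 * g)).
  by lra.
rewrite hg in h3; rewrite h3 in h2; lra.
Qed.

Lemma energy_upd_le (g : R) : 0 < g ->
  \sum_(x in Y) energy D (upd w Y x) (A :\ x) <=
  n * energy D w A + 2 * g * D ^+ 2 * n + (1 / (2 * g) + 2) * energy D w A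
  + 12 * W * r%:R * (2 * D * n + energy D w A / D).
Proof.
move=> g0; apply: (le_trans energy_upd_sum); apply: lerD.
  by rewrite -addrA lerD2l cross_le.
apply: ler_wpM2l; first by rewrite !mulr_ge0 // ltW.
rewrite -(ler_pM2r D0) mulrDl divfK ?gt_eqF //.
have := total_le; lra.
Qed.

Lemma upd_cases x l : upd w Y x l = w l \/ upd w Y x l = 0 \/
  alive w l /\ upd w Y x l = w l / (1 - rho Y l).
Proof.
case: (boolP (alive w l)) => h; last by left; rewrite upd_dead.
case: (boolP (inc x l)) => hi; first by right; left; rewrite upd_hit.
by right; right; rewrite upd_miss.
Qed.

Lemma upd_ge1 x l : upd w Y x l = 0 \/ 1 <= upd w Y x l.
Proof.
have [->|[->|[/andP[h _] ->]]] := upd_cases x l; [exact: w_cases|by left|right].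
have [e|h1] := w_cases l; first by rewrite e ltxx in h.
have /andP[h2 _] := inv_onem_rho l.
by rewrite -[leLHS]mulr1 ler_pM.
Qed.

Lemma alive_upd x l : alive (upd w Y x) l -> alive w l /\ ~~ inc x l.
Proof.
case: (boolP (alive w l)) => h; last by rewrite /alive upd_dead // => h'; rewrite /alive h' in h.
case: (boolP (inc x l)) => hi //.
by rewrite /alive upd_hit // ltxx.
Qed.

(** An alive line survives with probability [1 - rho Y l] and weight [w l / (1 - rho Y l)], so its
    mean entropy grows by [w l * ln (1 - rho Y l)^-1], at most [2 * rho Y l * w l]. These increments
    are summed by [total_le]. *)
Lemma entropy_upd_le :
  \sum_(x in Y) entropy (upd w Y x) <= n * entropy w + 4 * D * n + 2 * energy D w A / D.
Proof.
have key l : \sum_(x in Y) upd w Y x l * ln (upd w Y x l) <=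
    n * (w l * ln (w l)) + 2 * (aw w l * hits Y l).
  case: (boolP (alive w l)) => h; last first.
    rewrite /aw (negbTE h) mul0r mulr0 addr0 mulr_natl -sumr_const.
    by apply: ler_sum => x _; rewrite upd_dead.
  have /andP[w0 _] := h.
  have /andP[u1 u2] := inv_onem_rho l.
  have -> : \sum_(x in Y) upd w Y x l * ln (upd w Y x l) =
      (\sum_(x in Y) (~~ inc x l)%:R) * (w l / (1 - rho Y l) * ln (w l / (1 - rho Y l))).
    rewrite mulr_suml; apply: eq_bigr => x _.
    case: (boolP (inc x l)) => hi; first by rewrite upd_hit // !mul0r.
    by rewrite upd_miss // mul1r.
  rewrite mean_survival mulrA -(mulrA n) (mulrC (1 - _)) divfK //.
  have v0 : 0 < (1 - rho Y l)^-1 by apply: lt_le_trans u1.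
  rewrite lnM ?posrE // mulrDr -mulrA lerD2l hitsE /aw h.
  have hu : (1 - rho Y l)^-1 - 1 = rho Y l / (1 - rho Y l).
    by apply: (mulIf (onem_rho_neq0 l)); rewrite divfK // mulrBl mulVf //; lra.
  have hl : ln (1 - rho Y l)^-1 <= 2 * rho Y l.
    apply: (@le_trans _ _ ((1 - rho Y l)^-1 - 1)).
      move: (_^-1) v0 => u u0; have h1 : -1 < u - 1 by lra.
      by have := le_ln1Dx h1; rewrite (addrC 1) subrK.
    by rewrite hu mulrC ler_wpM2r ?rho_ge0.
  have : 0 <= n * w l by rewrite mulr_ge0 ?ltW.
  move=> /ler_wpM2l /(_ _ _ hl); lra.
rewrite /entropy exchange_big /=; apply: le_trans; first by apply: ler_sum => l _; exact: key.
rewrite big_split /= -!mulr_sumr -addrA lerD2l.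
have -> : \sum_i aw w i * hits Y i = total.
  rewrite (eq_bigr _ (fun l _ => mulr_sumr _ _ _ _)) exchange_big /=.
  apply: eq_bigr => x _; rewrite /load [RHS]big_mkcond; apply: eq_bigr => l _.
  by case: (inc x l); rewrite ?mulr1 ?mulr0.
rewrite -(ler_pM2r D0) [leRHS]mulrDl divfK ?gt_eqF //.
have := total_le; lra.
Qed.
End Step.

(** * Following a subtree *)

Lemma drift_bound1 (R : realFieldType) (a E s z : R) : a * E <= 1 / 16 -> 1 <= s ->
  4352 * s ^+ 2 <= z -> a * ((256 * s + 2) * E) * (256 * s) <= z.
Proof.
move=> aE s1; apply: le_trans.
have ss : s <= s ^+ 2 by rewrite ler_peMr //; lra.
have h : 0 <= (256 * s + 2) * (256 * s) by apply: mulr_ge0; lra.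
have := ler_wpM2l h aE; lra.
Qed.

Lemma drift_bound2 (R : realFieldType) (a D E ED n s z V : R) :
  0 <= a -> 0 <= ED -> 0 <= D -> 0 <= n -> 1 <= z -> a * D ^+ 2 * n = z ->
  ED * D = E -> a * E <= 1 / 16 -> 9216 * V * s <= D ->
  a * (12 * V * (2 * D * n + ED)) * (256 * s) <= z.
Proof.
move=> a0 ED0 D0 n0 z1 zE EDE aE DW.
have v0 : 0 <= a * (2 * D * n + ED) by rewrite !(addr_ge0, mulr_ge0).
have h := ler_wpM2l v0 DW.
have e : a * (2 * D * n + ED) * D = 2 * (a * D ^+ 2 * n) + a * (ED * D) by clear; lra.
rewrite zE EDE in e; rewrite e in h; clear - h aE z1; lra.
Qed.

Lemma drift_bound3 (R : realFieldType) (a b D E ED n s z l : R) :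
  0 <= b -> 0 <= ED -> 0 <= D -> 0 <= n -> 1 <= z -> a * D ^+ 2 * n = z ->
  ED * D = E -> a * E <= 1 / 16 -> b * l = a * D -> 1280 * s <= l ->
  b * (4 * D * n + 2 * ED) * (256 * s) <= z.
Proof.
move=> b0 ED0 D0 n0 z1 zE EDE aE bE lW.
have v0 : 0 <= b * (4 * D * n + 2 * ED) by rewrite !(addr_ge0, mulr_ge0).
have h := ler_wpM2l v0 lW.
have e : b * (4 * D * n + 2 * ED) * l = b * l * (4 * D * n + 2 * ED) by clear; lra.
have e' : a * D * (4 * D * n + 2 * ED) = 4 * (a * D ^+ 2 * n) + 2 * (a * (ED * D)) by clear; lra.
rewrite bE e' zE EDE in e; rewrite e in h; clear - h aE z1; lra.
Qed.

(** Four errors, two from the cross term, one from the variance and one from the entropy, each cost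
    at most [z / (256 * s)]; together at most [n * c]. Here [a] and [b] are the normalising factors
    of the potential, [V] is [W * r] and [l] is [ln W]. *)
Lemma drift_bound (R : realFieldType) (a b g D E H ED n s z l V SE SH c : R) :
  0 <= a -> 0 <= b -> 0 <= ED -> 0 <= D -> 0 <= n -> 1 <= s ->
  4352 * s ^+ 2 <= z -> a * D ^+ 2 * n = z -> g * (512 * s) = 1 ->
  ED * D = E -> a * E <= 1 / 16 -> b * l = a * D -> 1280 * s <= l ->
  9216 * V * s <= D -> n * c * (64 * s) = z ->
  SE <= n * E + 2 * g * D ^+ 2 * n + (256 * s + 2) * E + 12 * V * (2 * D * n + ED) ->
  SH <= n * H + 4 * D * n + 2 * ED ->
  SE * a + SH * b <= n * (E * a + H * b + c).
Proof.
move=> a0 b0 ED0 D0 n0 s1 sz zE gs EDE aE bE lW DW cz hE hH.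
have z1 : 1 <= z.
  apply: le_trans sz; clear - s1.
  have ss : s <= s ^+ 2 by rewrite ler_peMr //; lra.
  lra.
have t1 := drift_bound1 aE s1 sz.
have t2 := drift_bound2 a0 ED0 D0 n0 z1 zE EDE aE DW.
have t3 := drift_bound3 b0 ED0 D0 n0 z1 zE EDE aE bE lW.
have t4 : a * (2 * g * D ^+ 2 * n) * (256 * s) = z.
  have -> : a * (2 * g * D ^+ 2 * n) * (256 * s) = a * D ^+ 2 * n * (g * (512 * s)) by clear; lra.
  by rewrite gs mulr1.
have hE' := ler_wpM2l a0 hE; have hH' := ler_wpM2l b0 hH.
have h256 : 0 < 256 * s by rewrite mulr_gt0 // (lt_le_trans _ s1).
have hE2 := ler_wpM2r (ltW h256) hE'; have hH2 := ler_wpM2r (ltW h256) hH'.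
rewrite -(ler_pM2r h256).
clear - t1 t2 t3 t4 hE2 hH2 cz; lra.
Qed.

Lemma endgame_algebra (R : realFieldType) (r N D a f e cA cB : R) :
  0 < N * D ^+ 2 -> 7 / 8 * N * D ^+ 2 <= cA * D ^+ 2 ->
  8 * r * cB * D ^+ 2 <= N * D ^+ 2 -> e * r <= N * D ^+ 2 / 16 -> e <= e * r ->
  3 / 4 * cA * D ^+ 2 - e <= r * (a + f) * D ->
  a * D * r <= (2 * D ^+ 2 * cB + e) * r -> f * r * D <= N * D / 16 * D -> False.
Proof. lra. Qed.

(** * Playing down a rich subtree *)

Section Game.
Variables (R : realType) (X L : finType) (inc : X -> L -> bool).
Variables (W D s : R) (r y0 : nat).
Hypothesis linear : forall x y l l', x != y -> inc x l -> inc y l ->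
  inc x l' -> inc y l' -> l = l'.
Hypothesis card_line : forall l, \sum_(z | inc z l) 1 = r%:R :> R.
Hypothesis degree_le : forall z, \sum_(l | inc z l) 1 <= D.
Hypothesis r0 : (0 < r)%N.
Hypothesis s1 : 1 <= s.
Hypothesis W1 : 1 <= W.
Hypothesis lnW : 1280 * s <= ln W.
Hypothesis DW : 9216 * W * r%:R * s <= D.
Hypothesis y0D : D <= y0%:R.
Hypothesis y0_dense : 4352 * s ^+ 2 * #|X|%:R <= r%:R * y0%:R.
Hypothesis N0 : (0 < #|X|)%N.

Let N : R := #|X|%:R.

Let N_gt0 : 0 < N. Proof. by rewrite ltr0n. Qed.
Let r_gt0 : 0 < r%:R :> R. Proof. by rewrite ltr0n. Qed.
Let r_ge1 : 1 <= r%:R :> R. Proof. by rewrite ler1n. Qed.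
Let s_gt0 : 0 < s. Proof. exact: lt_le_trans s1. Qed.
Let W_gt0 : 0 < W. Proof. exact: lt_le_trans W1. Qed.
Let lnW_gt0 : 0 < ln W. Proof. have h := lnW; have h' := s_gt0; lra. Qed.
Let Wrs : W * r%:R <= W * r%:R * s.
Proof. by rewrite ler_peMr // mulr_ge0 // ltW. Qed.
Let Wr_ge : r%:R <= W * r%:R.
Proof. by rewrite ler_peMl // ltW. Qed.
Let D_gt0 : 0 < D. Proof. have h1 := Wrs; have h2 := Wr_ge; have h3 := r_gt0; have h4 := DW; lra. Qed.

(* Both summands are normalised by what the final estimate can afford. *)
Definition potential (w : L -> R) (A : {set X}) : R :=
  energy inc D w A * (r%:R / (N * D ^+ 2)) + entropy w * (r%:R / (N * D * ln W)).

(** Sized so that [t] steps with [t * r <= 2 * s * N] use at most 1/32, half of the allowed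
    potential. *)
Definition step_cost : R := r%:R / (64 * s * N).

Definition weights_ok (w : L -> R) (A : {set X}) : Prop :=
  (forall l, w l = 0 \/ 1 <= w l) /\
  (forall z l, alive W w l -> inc z l -> z \in A).

Lemma energy_ge0 (w : L -> R) (A : {set X}) : 0 <= energy inc D w A.
Proof. by apply: sumr_ge0 => z _; rewrite sqr_ge0. Qed.

Lemma entropy_term_ge0 (a : R) : a = 0 \/ 1 <= a -> 0 <= a * ln a.
Proof.
case=> [->|h]; first by rewrite mul0r.
by rewrite mulr_ge0 ?ln_ge0 // (le_trans ler01 h).
Qed.

Lemma entropy_ge0 (w : L -> R) : (forall l, w l = 0 \/ 1 <= w l) -> 0 <= entropy w.
Proof. by move=> h; apply: sumr_ge0 => l _; apply: entropy_term_ge0. Qed.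

Let ca : R := r%:R / (N * D ^+ 2).
Let cb : R := r%:R / (N * D * ln W).
Let ca_gt0 : 0 < ca.
Proof. by rewrite divr_gt0 // mulr_gt0 // exprn_gt0. Qed.
Let cb_gt0 : 0 < cb.
Proof. by rewrite divr_gt0 // !mulr_gt0. Qed.
Let caE : ca * D ^+ 2 = r%:R / N.
Proof.
by rewrite /ca -mulrA invfM -mulrA mulVf ?mulr1 // gt_eqF // exprn_gt0.
Qed.
Let cbE : cb * ln W = ca * D.
Proof.
have D0 : D != 0 by rewrite gt_eqF.
have l0 : ln W != 0 by rewrite gt_eqF.
by rewrite /cb /ca !invfM -!mulrA mulVf // mulr1 mulVf // mulr1.
Qed.

(** Averaging: the mean potential over [x] in [Y] rises by at most [step_cost], so some [x] does no
    worse. *)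
Lemma potential_step (w : L -> R) (A Y : {set X}) :
  weights_ok w A -> potential w A <= 1 / 16 -> (y0 <= #|Y|)%N ->
  exists x, [/\ x \in Y, weights_ok (upd inc W w Y x) (A :\ x) &
    potential (upd inc W w Y x) (A :\ x) <= potential w A + step_cost].
Proof.
move=> [wc wA] pot hY.
pose n : R := #|Y|%:R.
have yn : y0%:R <= n by rewrite ler_nat.
have Dn : D <= n := le_trans y0D yn.
have n_gt0 : 0 < n := lt_le_trans D_gt0 Dn.
have Y_gt0 : (0 < #|Y|)%N by rewrite -(ltr0n R).
have rho_half l : rho R inc Y l <= 1 / 2.
  rewrite /rho ler_pdivrMr //.
  have : hits R inc Y l <= r%:R.
    rewrite -(card_line l) /hits [leRHS]big_mkcond [leLHS]big_mkcond /=.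
    by apply: ler_sum => z _; case: (z \in Y); case: (inc z l).
  by have h1 := DW; have h2 := Wrs; have h3 := Wr_ge; have h4 := r_gt0; rewrite -/n; lra.
set E := energy inc D w A; set H := entropy w.
have E_ge0 : 0 <= E := energy_ge0 w A.
have H_ge0 : 0 <= H := entropy_ge0 wc.
have aE : ca * E <= 1 / 16.
  have := mulr_ge0 H_ge0 (ltW cb_gt0); move: pot.
  by rewrite /potential -/ca -/cb -/E -/H; lra.
have step_ok x : weights_ok (upd inc W w Y x) (A :\ x).
  split=> [l|z l hl hz]; first exact: upd_ge1.
  have [h1 h2] := alive_upd hl.
  rewrite !inE (wA z l) // andbT; apply: contra h2 => /eqP <-; exact: hz.
suff [x hx hle] : exists2 x, x \in Y &
    potential (upd inc W w Y x) (A :\ x) <= potential w A + step_cost.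
  by exists x; split.
(* With this [g] the normalised term [2 * g * D ^+ 2 * n] is exactly a quarter of the allowed
   drift. *)
pose g : R := 1 / (512 * s).
have g_gt0 : 0 < g by rewrite divr_gt0 // mulr_gt0.
have gs : g * (512 * s) = 1 by rewrite divfK // gt_eqF // mulr_gt0.
clearbody g.
have g2 : 1 / (2 * g) = 256 * s.
  have h : 2 * g != 0 by rewrite gt_eqF // mulr_gt0.
  by apply: (mulIf h); rewrite divfK //; lra.
have HE := energy_upd_le W_gt0 linear Y_gt0 rho_half D_gt0 card_line degree_le Dn wc wA g_gt0.
have HH := entropy_upd_le Y_gt0 rho_half D_gt0 wc wA.
rewrite -/n -/E -/H g2 in HE HH.
have [/existsP[x /andP[hx hle]]|] := boolP [exists x, (x \in Y) &&
  (potential (upd inc W w Y x) (A :\ x) <= potential w A + step_cost)].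
  by exists x.
rewrite negb_exists => /forallP hall; exfalso.
have : n * (potential w A + step_cost) < \sum_(x in Y) potential (upd inc W w Y x) (A :\ x).
  rewrite mulr_natl -sumr_const; apply: ltr_sum.
    by case/card_gt0P: Y_gt0 => x hx; apply/hasP; exists x; rewrite ?mem_index_enum.
  by move=> x hx; have := hall x; rewrite hx /= -ltNge.
apply/negP; rewrite -leNgt.
rewrite /potential -/ca -/cb -/E -/H big_split /= -!mulr_suml.
have un : 4352 * s ^+ 2 <= r%:R / N * n.
  rewrite mulrAC ler_pdivlMr //; apply: (le_trans y0_dense).
  by rewrite ler_pM2l.
have cost : n * step_cost * (64 * s) = r%:R / N * n.
  rewrite /step_cost invfM; move: (N^-1) => v.
  have : (64 * s)^-1 * (64 * s) = 1 by rewrite mulVf // gt_eqF // mulr_gt0.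
  move: (_^-1) => v' hv'.
  by transitivity (r%:R * v * n * (v' * (64 * s))); [lra|rewrite hv' mulr1].
have EDE : E / D * D = E by rewrite divfK // gt_eqF.
have DW' := DW; rewrite -!(mulrA _ W) in HE DW'.
apply: (drift_bound (ltW ca_gt0) (ltW cb_gt0) _ (ltW D_gt0) (ltW n_gt0) s1 un _ gs EDE
  aE cbE lnW DW' cost HE _) => //; first by rewrite divr_ge0 // ltW.
  by rewrite caE.
by rewrite mulrA.
Qed.

Let cost_ge0 : 0 <= step_cost.
Proof. by rewrite divr_ge0 // !mulr_ge0 // ltW. Qed.

(** At a branching node [potential_step] picks the child; at a forced node the point goes into [B],
    while the weights and [A] stay put. Hence a line alive at the end was missed by all free
    choices, and avoiding [B] makes it miss the forced ones too. *)
Lemma play (t j : nat) (Om : seq X -> bool) (w : L -> R) (A : {set X}) :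
  weights_ok w A -> potential w A + t%:R * step_cost <= 1 / 16 ->
  rich y0 t j Om ->
  exists q (w' : L -> R) (A' B : {set X}),
  Om q /\ [/\ weights_ok w' A', potential w' A' <= 1 / 16, (#|A| <= #|A'| + t)%N,
      (#|B| <= j)%N &
      forall l, alive W w' l -> (forall z, z \in B -> ~~ inc z l) ->
        alive W w l /\ forall z, z \in q -> ~~ inc z l].
Proof.
elim: t j Om w A => [|t IH] j Om w A wA pot /=.
  move=> hOm; exists [::], w, A, finset.set0; split=> //.
  split=> //; rewrite ?addn0 ?cards0 //.
  by move: pot; rewrite mul0r addr0.
have pot' : potential w A + t%:R * step_cost + step_cost <= 1 / 16.
  by move: pot; rewrite -natr1 mulrDl mul1r addrA.
case/orP=> [hY|].
  pose Y := [set x | rich y0 t j (fun q => Om (x :: q))].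
  have hY' : (y0 <= #|Y|)%N.
    by apply: leq_trans hY _; apply: subset_leq_card; apply/fintype.subsetP => x; rewrite !inE.
  have tc : 0 <= t%:R * step_cost by rewrite mulr_ge0.
  have potw : potential w A <= 1 / 16.
    by apply: le_trans pot'; rewrite -addrA lerDl addr_ge0.
  have [x [hx wA1 pot1]] := potential_step wA potw hY'.
  have hp : potential (upd inc W w Y x) (A :\ x) + t%:R * step_cost <= 1 / 16.
    by apply: le_trans pot'; rewrite [leRHS]addrAC lerD2r.
  rewrite inE in hx.
  have [q [w' [A' [B [h1 [h2 h3 h4 h5 h6]]]]]] := IH _ _ _ _ wA1 hp hx.
  exists (x :: q), w', A', B; split=> //; split=> //.
    by rewrite (cardsD1 x A) addnS; apply: leq_trans (leq_add (leq_b1 _) h4) _; rewrite add1n.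
  move=> l hl hB; have [ha hq] := h6 l hl hB; have [ha' hx'] := alive_upd ha.
  split=> // z; rewrite inE => /orP[/eqP->//|]; exact: hq.
case: j => // j /existsP[x hx].
have hp : potential w A + t%:R * step_cost <= 1 / 16.
  by apply: le_trans pot'; rewrite lerDl.
have [q [w' [A' [B [h1 [h2 h3 h4 h5 h6]]]]]] := IH _ _ _ _ wA hp hx.
exists (x :: q), w', A', (x |: B); split=> //; split=> //.
- by apply: (leq_trans h4); rewrite leq_add2l.
- by rewrite cardsU1; apply: leq_trans (leq_add (leq_b1 _) h5) _.
move=> l hl hB.
have [ha hq] := h6 l hl (fun z hz => hB z (finset.setU1r x hz)).
split=> // z; rewrite inE => /orP[/eqP->|]; last exact: hq.
exact/hB/finset.setU11.
Qed.

Lemma alive_line_avoiding (w : L -> R) (A B : {set X}) :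
  weights_ok w A -> potential w A <= 1 / 16 ->
  7 / 8 * N <= #|A|%:R -> 8 * r%:R * #|B|%:R <= N ->
  exists2 l, alive W w l & forall z, z \in B -> ~~ inc z l.
Proof.
move=> [wc wA] pot cA cB.
have w_ge0 l : 0 <= w l by case: (wc l) => [->//|]; apply: le_trans.
have [/existsP[l /andP[hl /forallP hB]]|] := boolP [exists l, alive W w l &&
   [forall z, (z \in B) ==> ~~ inc z l]].
  by exists l => // z hz; have := hB z; rewrite hz.
rewrite negb_exists => /forallP hall; exfalso.
set E := energy inc D w A; set H := entropy w.
have E0 : 0 <= E := energy_ge0 w A.
have H0 : 0 <= H := entropy_ge0 wc.
pose EB := \sum_(z in A :&: B) (load inc w z - D) ^+ 2.
have load_ge0 z : 0 <= load inc w z by apply: sumr_ge0.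
have lower : (3 / 4 * #|A|%:R) * D ^+ 2 - E <= (\sum_z load inc w z) * D.
  have h : (\sum_(z in A) load inc w z) * D <= (\sum_z load inc w z) * D.
    rewrite ler_pM2r // [leRHS](bigID (mem A)) /= lerDl.
    exact: sumr_ge0.
  apply: le_trans h.
  rewrite (_ : 3 / 4 * _ * _ = \sum_(z in A) 3 / 4 * D ^+ 2); last first.
    by rewrite sumr_const -[RHS]mulr_natl [RHS]mulrA (mulrC #|A|%:R).
  rewrite /E /energy -sumrB mulr_suml; apply: ler_sum => z _.
  move: (load inc w z) => a; have := sqr_ge0 (a - D + D / 2); lra.
have upper : (\sum_(l | alive W w l) w l) * D <= 2 * D ^+ 2 * #|B|%:R + E.
  have h1 : \sum_(l | alive W w l) w l <= \sum_(z in A :&: B) load inc w z.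
    rewrite /load (exchange_big_dep xpredT) //= [leLHS]big_mkcond /=.
    apply: ler_sum => l _; case: ifP => [hl|_]; last by apply: sumr_ge0.
    have := hall l; rewrite hl /= negb_forall => /existsP[z].
    rewrite negb_imply negbK => /andP[zB zl].
    rewrite (bigD1 z) /=; last by rewrite !inE zB (wA z l) // zl.
    by rewrite lerDl; apply: sumr_ge0.
  apply: (@le_trans _ _ ((\sum_(z in A :&: B) load inc w z) * D)).
    by rewrite ler_pM2r.
  apply: (@le_trans _ _ (2 * D ^+ 2 * #|A :&: B|%:R + EB)).
    rewrite mulrC mulr_natr -sumr_const mulr_sumr -big_split /=; apply: ler_sum => z _.
    move: (load inc w z) => a; have := sqr_ge0 (a - D - D / 2); have := sqr_ge0 D; lra.
  apply: lerD; last exact: energy_sub_le.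
  rewrite ler_pM2l ?mulr_gt0 ?exprn_gt0 // ler_nat.
  by apply: subset_leq_card; apply: subsetIr.
have frozen : (\sum_(l | ~~ alive W w l) w l) * ln W <= H.
  rewrite mulr_suml /H /entropy big_mkcond /=; apply: ler_sum => l _.
  case: ifP => [|_]; last exact: entropy_term_ge0.
  rewrite /alive negb_and -!leNgt -ltNge => /orP[h|h].
    have -> : w l = 0 by apply/eqP; rewrite eq_le h w_ge0.
    by rewrite !mul0r.
  by rewrite ler_wpM2l ?w_ge0 // ler_ln ?posrE ?(ltW h) // (lt_trans _ h).
have tot : \sum_z load inc w z = r%:R * \sum_l w l.
  rewrite /load (exchange_big_dep xpredT) //= mulr_sumr; apply: eq_bigr => l _.
  by rewrite -(card_line l) mulr_suml; apply: eq_bigr => z _; rewrite mul1r.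
have split_w : \sum_l w l = \sum_(l | alive W w l) w l + \sum_(l | ~~ alive W w l) w l.
  by rewrite (bigID (alive W w)).
have potE : E * r%:R / (N * D ^+ 2) + H * r%:R / (N * D * ln W) <= 1 / 16.
  by move: pot; rewrite /potential !mulrA.
have pE : E * r%:R <= N * D ^+ 2 / 16.
  have : E * r%:R / (N * D ^+ 2) <= 1 / 16.
    apply: le_trans potE; rewrite lerDl.
    by rewrite !(divr_ge0, mulr_ge0) // ltW.
  rewrite ler_pdivrMr ?mulr_gt0 ?exprn_gt0 //.
  by rewrite mulrAC mul1r.
have pH : H * r%:R <= N * D * ln W / 16.
  have : H * r%:R / (N * D * ln W) <= 1 / 16.
    apply: le_trans potE; rewrite lerDr.
    by rewrite !(divr_ge0, mulr_ge0) ?exprn_ge0 // ltW.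
  rewrite ler_pdivrMr ?mulr_gt0 //.
  by rewrite mulrAC mul1r.
have pF : (\sum_(l | ~~ alive W w l) w l) * r%:R <= N * D / 16.
  rewrite -(ler_pM2r lnW_gt0); apply: (@le_trans _ _ (H * r%:R)).
    by rewrite mulrAC ler_pM2r.
  by apply: (le_trans pH); rewrite mulrAC.
have {}frozen := ler_wpM2r (ltW D_gt0) pF.
have {}upper := ler_wpM2r (ltW r_gt0) upper.
rewrite tot split_w in lower.
have DD : 0 < D ^+ 2 by rewrite exprn_gt0.
have {}cA := ler_wpM2r (ltW DD) cA; have {}cB := ler_wpM2r (ltW DD) cB.
have EE : E <= E * r%:R by rewrite ler_peMr.
have NDD : 0 < N * D ^+ 2 by rewrite mulr_gt0.
exact: (endgame_algebra NDD cA cB pE EE lower upper frozen).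
Qed.

End Game.

Definition hitting {X L : finType} (inc : X -> L -> bool) (q : seq X) : bool :=
  [forall l, has (inc^~ l) q].

Lemma initial_budget (R : realFieldType) (E r N D s t : R) :
  0 < N -> 0 < D -> 0 < s -> 32 * r * E <= N * D ^+ 2 -> t * r <= 2 * s * N ->
  E * (r / (N * D ^+ 2)) + t * (r / (64 * s * N)) <= 1 / 16.
Proof.
move=> N0 D0 s0 h1 h2.
have -> : 1 / 16 = 1 / 32 + 1 / 32 :> R by clear; lra.
apply: lerD; rewrite mulrA ler_pdivrMr ?mulr_gt0 ?exprn_gt0 //.
  clear - h1; lra.
clear - h2; lra.
Qed.

(** Start with all weights 1: the entropy vanishes and the energy is the degree defect. Were the
    hitting tuples rich, [play] and [alive_line_avoiding] would give a hitting branch and a line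
    that it misses. *)
Lemma hitting_not_rich (R : realType) (X L : finType) (inc : X -> L -> bool)
    (W D s : R) (r y0 t j : nat) :
  (forall x y l l', x != y -> inc x l -> inc y l -> inc x l' -> inc y l' -> l = l') ->
  (forall l, \sum_(z | inc z l) 1 = r%:R :> R) ->
  (forall z, \sum_(l | inc z l) 1 <= D) ->
  32 * r%:R * \sum_z ((\sum_(l | inc z l) 1) - D) ^+ 2 <= #|X|%:R * D ^+ 2 ->
  (0 < r)%N -> (0 < #|X|)%N -> 1 <= s -> 1 <= W -> 1280 * s <= ln W ->
  9216 * W * r%:R * s <= D -> D <= y0%:R ->
  4352 * s ^+ 2 * #|X|%:R <= r%:R * y0%:R ->
  t%:R * r%:R <= 2 * s * #|X|%:R -> 8 * t%:R <= #|X|%:R :> R ->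
  8 * r%:R * j%:R <= #|X|%:R :> R ->
  ~~ rich y0 t j (hitting inc).
Proof.
move=> lin cl dl defect r0 N0 s1 W1 lnW DW y0D y0d ts tN jN.
have N_gt0 : 0 < #|X|%:R :> R by rewrite ltr0n.
have r_gt0 : 0 < r%:R :> R by rewrite ltr0n.
have s_gt0 : 0 < s by apply: lt_le_trans s1.
have D_gt0 : 0 < D.
  apply: lt_le_trans DW; rewrite !mulr_gt0 //; exact: lt_le_trans W1.
apply/negP => hr.
have wok : weights_ok inc W (fun=> 1) [set: X].
  by split=> [l|z l _ _]; [right|rewrite inE].
have pot : potential inc W D r (fun=> 1) [set: X] + t%:R * step_cost X s r <= 1 / 16.
  rewrite /potential /entropy big1 => [|l _]; last by rewrite ln1 mulr0.
  rewrite mul0r addr0 /step_cost.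
  have -> : energy inc D (fun=> 1) [set: X] = \sum_z ((\sum_(l | inc z l) 1) - D) ^+ 2.
    by apply: eq_bigl => z; rewrite inE.
  exact: initial_budget.
have [q [w' [A' [B [hq [wok' pot' cA cB hl]]]]]] :=
  play lin cl dl r0 s1 W1 lnW DW y0D y0d N0 wok pot hr.
have cA' : 7 / 8 * #|X|%:R <= #|A'|%:R :> R.
  have : #|X|%:R <= #|A'|%:R + t%:R :> R by rewrite -natrD ler_nat -cardsT.
  move: tN; clear; lra.
have cB' : 8 * r%:R * #|B|%:R <= #|X|%:R :> R.
  by apply: le_trans jN; rewrite ler_pM2l ?mulr_gt0 // ler_nat.
have [l al lB] := alive_line_avoiding cl r0 s1 W1 lnW DW N0 wok' pot' cA' cB'.
have [_ hq'] := hl l al lB.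
by move: hq => /forallP/(_ l)/hasP[z zq zl]; rewrite (negbTE (hq' z zq)) in zl.
Qed.

(** * Random subsets *)

(** The product measure that keeps each point independently with probability [p]. *)
Definition density (R : realFieldType) (X : finType) (p : R) (P : {set X}) : R :=
  \prod_x (if x \in P then p else 1 - p).

Lemma density_ge0 (R : realFieldType) (X : finType) (p : R) (P : {set X}) :
  0 <= p <= 1 -> 0 <= density p P.
Proof.
move=> /andP[p0 p1]; apply: prodr_ge0 => x _; case: ifP => _ //.
by rewrite subr_ge0.
Qed.

Lemma density_mul (R : realFieldType) (X : finType) (p : R) (f : X -> R) :
  \sum_(P : {set X}) density p P * \prod_(x in P) f x = \prod_x (p * f x + (1 - p)).
Proof.
rewrite bigA_distr; apply: eq_bigr => P _.
rewrite /density [X in _ * X]big_mkcond -big_split; apply: eq_bigr => x _ /=.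
by case: ifP => _; rewrite ?mulr1.
Qed.

Lemma density_sum (R : realFieldType) (X : finType) (p : R) :
  \sum_(P : {set X}) density p P = 1.
Proof.
have := density_mul p (fun _ : X => 1).
rewrite (eq_bigr (fun P => density p P)) => [->|P _]; last by rewrite big1 ?mulr1.
by rewrite big1 // => x _; rewrite mulr1 addrC subrK.
Qed.

Lemma density_sup (R : realFieldType) (X : finType) (p : R) (S : {set X}) :
  \sum_(P : {set X} | S \subset P) density p P = p ^+ #|S|.
Proof.
have -> : \sum_(P : {set X} | S \subset P) density p P =
    \sum_(P : {set X}) \prod_x (if x \in P then p else if x \in S then 0 else 1 - p).
  rewrite big_mkcond; apply: eq_bigr => P _; case: ifP => h.
    apply: eq_bigr => x _; case: ifP => // hx; case: ifP => // hS.
    by rewrite (fintype.subsetP h x hS) in hx.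
  move/negbT: h => /fintype.subsetPn[x xS xP].
  by rewrite (bigD1 x) //= (negbTE xP) xS mul0r.
rewrite -(bigA_distr _ _ (fun=> p)).
rewrite (bigID (mem S)) /= [X in _ * X]big1 => [|x /negbTE ->]; last by rewrite addrC subrK.
rewrite mulr1 -prodr_const; apply: eq_bigr => x ->; exact: addr0.
Qed.

Lemma density_card (R : realFieldType) (X : finType) (p : R) :
  \sum_(P : {set X}) density p P * #|P|%:R = p * #|X|%:R.
Proof.
transitivity (\sum_(P : {set X}) \sum_(x | [set x] \subset P) density p P).
  apply: eq_bigr => P _; rewrite (eq_bigl (mem P)); last by move=> x; rewrite finset.sub1set.
  by rewrite sumr_const mulr_natr.
rewrite (exchange_big_dep xpredT) //=.
transitivity (\sum_(x : X) p); last by rewrite sumr_const mulr_natr.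
by apply: eq_bigr => x _; rewrite density_sup cards1 expr1.
Qed.

Lemma density_line (R : realFieldType) (X : finType) (p : R) (l : pred X) :
  \sum_(P : {set X}) density p P * (1 / 2) ^+ #|[pred x in P | l x]| =
  (1 - p / 2) ^+ #|l|.
Proof.
rewrite (eq_bigr (fun P => density p P * \prod_(x in P) (if l x then 1 / 2 else 1))).
  rewrite density_mul (bigID l) /= [X in _ * X]big1 ?mulr1.
    by rewrite -prodr_const; apply: eq_bigr => x ->; lra.
  by move=> x /negbTE ->; rewrite mulr1 addrC subrK.
by move=> P _; rewrite -big_mkcondr /= -prodr_const.
Qed.

Lemma extend_subset (X : finType) (S P : {set X}) (t : nat) :
  S \subset P -> (#|S| <= t)%N -> (t <= #|P|)%N ->
  exists S' : {set X}, [/\ S \subset S', S' \subset P & #|S'| = t].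
Proof.
move=> SP St tP.
have [k hk] : {k : nat | (t = #|S| + k)%N} by exists (t - #|S|)%N; rewrite subnKC.
elim: k t hk {St} tP => [|k IH] t hk tP.
  by exists S; rewrite hk addn0; split.
have tP' : (#|S| + k <= #|P|)%N by apply: leq_trans tP; rewrite hk leq_add2l.
have [S' [h1 h2 h3]] := IH _ erefl tP'.
have : S' \proper P.
  by rewrite properEcard h2 h3; apply: leq_trans tP; rewrite hk addnS.
move=> /properP[_ [x xP xS']]; exists (x |: S'); split.
- by apply: (fintype.subset_trans h1); rewrite finset.subsetUr.
- by rewrite finset.subUset finset.sub1set xP.
- by rewrite cardsU1 xS' h3 hk addnS.
Qed.

(* First moment method: [t`!] orderings of each hitting set of size [t], the
   weight [2 ^ (k - #|P :&: l|)] of each line and Markov for [#|P|]. *)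
Lemma exists_sparse_subset (R : realFieldType) (X L : finType) (inc : X -> L -> bool)
    (p M d : R) (r t k : nat) :
  0 < p <= 1 -> (0 < #|X|)%N -> 0 < d ->
  (forall l, #|[pred z | inc z l]| = r) ->
  (forall z, \sum_(l | inc z l) 1 <= d) ->
  \sum_(q : t.-tuple X) (hitting inc q)%:R <= M ->
  M * p ^+ t / t`!%:R + #|L|%:R * (2 ^+ k * (1 - p / 2) ^+ r) < 3 / 4 ->
  d * t%:R <= #|L|%:R * k%:R ->
  exists P : {set X}, [/\ #|P|%:R <= 4 * (p * #|X|%:R),
    #|L|%:R * k%:R <= d * #|P|%:R,
    (forall l, (k <= #|[pred x in P | inc x l]|)%N) &
    forall S : {set X}, S \subset P -> (forall l, exists2 x, x \in S & inc x l) ->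
      (t <= #|S|)%N].
Proof.
move=> /andP[p0 p1] N0 d0 cl dl hM hbad dt.
have N_gt0 : 0 < #|X|%:R :> R by rewrite ltr0n.
have f_gt0 : 0 < t`!%:R :> R by rewrite ltr0n fact_gt0.
pose good (q : seq X) := hitting inc q && uniq q.
(* Penalties: [b1 P >= 1] if [P] contains a hitting set of size [t], [b2 P >= 1] if some line has
   fewer than [k] points in [P], [b3 P > 1] if [P] is too large. A mean total below 1 yields a [P]
   free of all three defects. *)
pose b1 (P : {set X}) : R :=
  \sum_(q : t.-tuple X) (good q && ([set x in q] \subset P))%:R / t`!%:R.
pose b2 (P : {set X}) : R :=
  \sum_l 2 ^+ k * (1 / 2) ^+ #|[pred x in P | inc x l]|.
pose b3 (P : {set X}) : R := #|P|%:R / (4 * (p * #|X|%:R)).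
have mu0 (P : {set X}) : 0 <= density p P by apply: density_ge0; rewrite ltW.
have s1 : \sum_P density p P * b1 P <= M * p ^+ t / t`!%:R.
  rewrite (eq_bigr (fun P : {set X} => \sum_(q : t.-tuple X)
     (density p P * (good q && ([set x in q] \subset P))%:R / t`!%:R))); last first.
    by move=> P _; rewrite mulr_sumr; apply: eq_bigr => q _; rewrite mulrA.
  rewrite exchange_big /=.
  apply: (@le_trans _ _ (\sum_(q : t.-tuple X) (hitting inc q)%:R * (p ^+ t / t`!%:R))).
    apply: ler_sum => q _; rewrite -mulr_suml mulrA ler_pM2r ?invr_gt0 //.
    case: (boolP (good q)) => [/andP[-> uq]|_] /=; last first.
      by rewrite big1 => [|P _]; rewrite ?mulr0 ?mulr_ge0 ?exprn_ge0 // ltW.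
    rewrite mul1r.
    have cq : #|[set x in q]| = t by rewrite cardsE (card_uniqP uq) size_tuple.
    rewrite -[X in p ^+ X]cq -density_sup big_mkcond [leRHS]big_mkcond /=; apply: ler_sum => P _.
    by case: ifP => _; rewrite ?mulr1 ?mulr0.
  by rewrite -mulr_suml -mulrA ler_wpM2r // divr_ge0 ?exprn_ge0 // ltW.
have s2 : \sum_P density p P * b2 P = #|L|%:R * (2 ^+ k * (1 - p / 2) ^+ r).
  rewrite (eq_bigr (fun P : {set X} => \sum_l
     2 ^+ k * (density p P * (1 / 2) ^+ #|[pred x in P | inc x l]|))); last first.
    by move=> P _; rewrite mulr_sumr; apply: eq_bigr => l _; rewrite mulrCA.
  rewrite exchange_big /= mulr_natl -sumr_const; apply: eq_bigr => l _.
  by rewrite -mulr_sumr (density_line p (inc^~ l)) cl.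
have s3 : \sum_P density p P * b3 P = 1 / 4.
  rewrite (eq_bigr (fun P : {set X} => density p P * #|P|%:R / (4 * (p * #|X|%:R)))); last first.
    by move=> P _; exact: mulrA.
  rewrite -mulr_suml density_card invfM mulrCA divff ?mulr1 ?mul1r //.
  by rewrite gt_eqF // mulr_gt0.
have [P hP] : exists P, b1 P + b2 P + b3 P < 1.
  apply/not_existsP => h.
  have : \sum_(P : {set X}) density p P <= \sum_P density p P * (b1 P + b2 P + b3 P).
    apply: ler_sum => P _; rewrite -[leLHS]mulr1 ler_wpM2l //.
    by have := h P; rewrite leNgt => /negP.
  rewrite density_sum; under eq_bigr do rewrite !mulrDr.
  rewrite !big_split /= s2 s3; apply/negP; rewrite -ltNge.
  rewrite [ltRHS](_ : 1 = 3 / 4 + 1 / 4); last by clear; lra.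
  by rewrite ltrD2r; apply: le_lt_trans hbad; rewrite lerD2r.
have b1_ge0 : 0 <= b1 P by apply: sumr_ge0 => q _; rewrite divr_ge0.
have b2_term l : 0 <= 2 ^+ k * (1 / 2) ^+ #|[pred x in P | inc x l]| :> R.
  by rewrite mulr_ge0 ?exprn_ge0 // divr_ge0.
have b2_ge0 : 0 <= b2 P by apply: sumr_ge0.
have b3_ge0 : 0 <= b3 P by rewrite divr_ge0 // !mulr_ge0 // ltW.
have kP l : (k <= #|[pred x in P | inc x l]|)%N.
  rewrite leqNgt; apply/negP => hlt.
  have : 1 <= b2 P.
    rewrite /b2 (bigD1 l) //=.
    apply: (@le_trans _ _ (2 ^+ k * (1 / 2) ^+ #|[pred x in P | inc x l]|)).
      rewrite div1r exprVn ler_pdivlMr ?exprn_gt0 // mul1r.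
      by rewrite ler_weXn2l ?ler1n // ltnW.
    by rewrite lerDl; apply: sumr_ge0.
  by move: hP b1_ge0 b3_ge0; clear; lra.
have LP : #|L|%:R * k%:R <= d * #|P|%:R.
  apply: (@le_trans _ _ (\sum_l \sum_(x in P | inc x l) 1)).
    rewrite mulr_natl -sumr_const; apply: ler_sum => l _.
    by rewrite sumr_const ler_nat kP.
  rewrite (exchange_big_dep (mem P)) /=; last by move=> l x _ /andP[].
  rewrite mulr_natr -sumr_const; apply: ler_sum => x xP.
  by apply: le_trans (dl x); rewrite (eq_bigl (fun l => inc x l)) // => l; rewrite xP.
have tP : (t <= #|P|)%N.
  by rewrite -(ler_nat R) -(ler_pM2l d0); apply: le_trans LP.
exists P; split=> //.
  have : b3 P <= 1 by move: hP b1_ge0 b2_ge0; clear; lra.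
  by rewrite ler_pdivrMr ?mul1r // !mulr_gt0.
move=> S SP hS; rewrite leqNgt; apply/negP => hlt.
have [S' [SS' S'P cS']] := extend_subset SP (ltnW hlt) tP.
have : 1 <= b1 P.
  rewrite /b1 -mulr_suml ler_pdivlMr // mul1r.
  have -> : t`! = #|[set q : t.-tuple X | all (mem S') q & uniq q]|.
    by rewrite card_uniq_tuples cS' ffactnn.
  rewrite -sum1_card natr_sum big_mkcond; apply: ler_sum => q _.
  rewrite inE; case: ifP => // /andP[qS uq].
  have qE : [set x in q] = S'.
    apply/eqP; rewrite eqEcard cS' cardsE (card_uniqP uq) size_tuple leqnn andbT.
    by apply/fintype.subsetP => x; rewrite inE => /(allP qS).
  rewrite /good uq qE S'P !andbT ler1n lt0b; apply/forallP => l.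
  have [x xS xl] := hS l; apply/hasP; exists x => //.
  by have := fintype.subsetP SS' x xS; rewrite -qE inE.
by move: hP b2_ge0 b3_ge0; clear; lra.
Qed.

(** * The grid *)

(** A crude Stirling bound: [(1 + 1 / t) ^ t] is at most [e], and [e <= 4] follows from
    [expR (- 2^-1) >= 2^-1]. *)
Lemma pow_le_fact (R : realType) (t : nat) : t%:R ^+ t <= 4 ^+ t * t`!%:R :> R.
Proof.
elim: t => [|t IH]; first by rewrite !expr0 mul1r.
have [->|t0] := posnP t; first by rewrite !expr1 mulr1 ler1n.
have tgt : 0 < t%:R :> R by rewrite ltr0n.
have h : t.+1%:R ^+ t <= 4 * t%:R ^+ t :> R.
  have e : t.+1%:R = (1 + t%:R^-1) * t%:R :> R.
    by rewrite mulrDl mulVf ?gt_eqF // mul1r natr1.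
  rewrite {1}e exprMn ler_pM2r ?exprn_gt0 //.
  apply: (@le_trans _ _ (expR (t%:R^-1) ^+ t)).
    by rewrite lerXn2r ?nnegrE ?expR_ge0 ?expR_ge1Dx // addr_ge0 // invr_ge0 ltW.
  rewrite -expRM_natl mulfV ?gt_eqF //.
  have : 2^-1 <= expR (- 2^-1) :> R.
    by have := expR_ge1Dx (- 2^-1 : R); apply: le_trans; lra.
  have h2 : expR (2^-1) ^+ 2 = expR 1 :> R.
    by rewrite -expRM_natl mulfV // pnatr_eq0.
  rewrite expRN -h2 => h3.
  have p := expR_gt0 (2^-1 : R).
  move: h3; rewrite lef_pV2 ?posrE // => h3.
  have -> : 4 = 2 ^+ 2 :> R by rewrite expr2; clear; lra.
  by rewrite lerXn2r ?nnegrE // ltW.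
rewrite factS natrM exprS [4 ^+ _]exprS.
apply: (@le_trans _ _ (t.+1%:R * (4 * (4 ^+ t * t`!%:R)))).
  rewrite ler_pM2l ?ltr0n //; apply: (le_trans h).
  by rewrite ler_pM2l.
by rewrite le_eqVlt; apply/orP; left; apply/eqP; clear; lra.
Qed.

Lemma one_sub_inv_pow (R : realType) (n : nat) : (0 < n)%N ->
  (1 - n%:R^-1) ^+ n <= 1 / 2 :> R.
Proof.
move=> n0; have ngt : 0 < n%:R :> R by rewrite ltr0n.
have n1 : n%:R^-1 <= 1 :> R by rewrite invf_le1 // ler1n.
apply: (@le_trans _ _ (expR (- n%:R^-1) ^+ n)).
  by rewrite lerXn2r ?nnegrE ?expR_ge0 ?expR_ge1Dx // subr_ge0.
rewrite -expRM_natl mulrN mulfV ?gt_eqF // expRN div1r lef_pV2 ?posrE ?expR_gt0 //.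
by have := expR_ge1Dx (1 : R); apply: le_trans; lra.
Qed.

Lemma ln2_ge_half (R : realType) : 1 / 2 <= ln 2 :> R.
Proof.
rewrite -ler_expR lnK ?posrE //.
have : 2^-1 <= expR (- 2^-1) :> R.
  by have := expR_ge1Dx (- 2^-1 : R); apply: le_trans; lra.
rewrite expRN lef_pV2 ?posrE ?expR_gt0 //.
by rewrite div1r.
Qed.

Lemma ln2_le1 (R : realType) : ln 2 <= 1 :> R.
Proof.
rewrite -ler_expR lnK ?posrE //.
by have := expR_ge1Dx (1 : R); apply: le_trans; lra.
Qed.

(** * Incidences between grid points and lines *)

Definition on_line (r H D B : nat) (z : 'I_r * 'I_H) (l : 'I_D * 'I_B) : bool :=
  (z.2 == l.1 * z.1 + l.2 :> nat)%N.

Section Grid.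
Variables (R : realType) (r D B : nat).
Let H := (B + r * D)%N.
Notation inc := (@on_line r H D B).

Lemma on_line_linear (x y : 'I_r * 'I_H) (l l' : 'I_D * 'I_B) :
  x != y -> inc x l -> inc y l -> inc x l' -> inc y l' -> l = l'.
Proof.
case: x y l l' => [x1 x2] [y1 y2] [a b] [a' b']; rewrite /on_line /=.
move=> xy /eqP h1 /eqP h2 /eqP h3 /eqP h4.
have xy1 : (x1 : nat) != y1.
  apply: contra xy => /eqP e; apply/eqP; congr pair; apply: val_inj => //=.
  by rewrite h1 h2 e.
have ea : (a : nat) = a' by move: xy1 h1 h2 h3 h4 => /eqP; nia.
have eb : (b : nat) = b' by move: h1; rewrite h3 ea; lia.
by congr pair; apply: val_inj.
Qed.

(** [H] equals [B + r * D], so no line leaves the grid in any of the [r] columns. *)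
Lemma on_line_card (l : 'I_D * 'I_B) : #|[pred z | inc z l]| = r.
Proof.
case: l => a b.
have hlt (x : 'I_r) : (a * x + b < H)%N.
  by rewrite /H; have := ltn_ord a; have := ltn_ord b; have := ltn_ord x; nia.
have -> : #|[pred z | inc z (a, b)]| = #|[set (x, Ordinal (hlt x)) | x : 'I_r]|.
  apply: eq_card => -[x y]; rewrite !inE /on_line /=; apply/idP/imsetP.
    by move=> /eqP h; exists x => //; congr pair; apply: val_inj.
  by case=> x' _ [-> ->].
by rewrite card_imset ?card_ord // => x x' [->].
Qed.

Lemma on_line_degree_le (z : 'I_r * 'I_H) : \sum_(l | inc z l) 1 <= D%:R :> R.
Proof.
rewrite sumr_const ler_nat.
rewrite -[X in (_ <= X)%N](card_ord D).
have -> : #|[pred l | inc z l]| = #|[set l.1 | l in [pred l | inc z l]]|.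
  rewrite card_in_imset // => -[a b] [a' b']; rewrite !inE /on_line /=.
  move=> /eqP h /eqP h' e; rewrite e in h *.
  by congr pair; apply: val_inj => /=; lia.
exact: max_card.
Qed.

Lemma on_line_degree (z : 'I_r * 'I_H) : (r * D <= z.2)%N -> (z.2 < B)%N ->
  \sum_(l | inc z l) 1 = D%:R :> R.
Proof.
case: z => x y /= h1 h2.
(* The intercept for slope [a]. The subtraction is truncated; [r * D <= y] makes it exact below. *)
have hlt (a : 'I_D) : (y - a * x < B)%N by lia.
rewrite sumr_const; congr (_%:R).
have -> : #|[pred l | inc (x, y) l]| = #|[set (a, Ordinal (hlt a)) | a : 'I_D]|.
  apply: eq_card => -[a b]; rewrite !inE /on_line /=; apply/idP/imsetP.
    by move=> /eqP h; exists a => //; congr pair; apply: val_inj => /=; lia.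
  case=> a' _ [-> ->] /=.
  have : (a' * x <= r * D)%N by have := ltn_ord a'; have := ltn_ord x; nia.
  lia.
by rewrite card_imset ?card_ord // => a a' [->].
Qed.

(** Only rows below [r * D] or from [B] on can be defective: at most [2 * r * D] of them, with each
    point losing at most [D] lines. The factor [64 * r ^ 2] in the bound on [B] absorbs this. *)
Lemma on_line_defect : (64 * r ^ 2 * D <= B)%N ->
  32 * r%:R * \sum_z ((\sum_(l | inc z l) 1) - D%:R) ^+ 2
    <= #|[set: 'I_r * 'I_H]|%:R * D%:R ^+ 2 :> R.
Proof.
move=> hB.
have D2 : 0 <= D%:R ^+ 2 :> R by rewrite sqr_ge0.
pose bad := [pred y : 'I_H | ~~ ((r * D <= y)%N && (y < B)%N)].
have cbad : (#|bad| <= 2 * (r * D))%N.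
  have hK (i : 'I_(2 * (r * D))) : ((if i < r * D then i : nat else i - r * D + B) < H)%N.
    by have := ltn_ord i; rewrite /H; case: ifP; lia.
  rewrite -[X in (_ <= X)%N](card_ord (2 * (r * D))).
  apply: leq_trans (leq_imset_card (fun i => Ordinal (hK i)) _).
  apply: subset_leq_card; apply/fintype.subsetP => y; rewrite inE => hy; apply/imsetP.
  have {}hy : (y < r * D)%N || (B <= y)%N by move: hy; rewrite negb_and -ltnNge -leqNgt.
  have yH : (y < B + r * D)%N := ltn_ord y.
  have hlt : ((if y < r * D then y : nat else y - B + r * D) < 2 * (r * D))%N.
    by move: hy; case: (ltnP y (r * D)) => /= h; lia.
  exists (Ordinal hlt) => //; apply: val_inj => /=.
  by move: hy; case: (ltnP y (r * D)) => /= h hy; rewrite ?h //; case: ltnP; lia.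
have key (z : 'I_r * 'I_H) :
    ((\sum_(l | inc z l) 1) - D%:R) ^+ 2 <= (z.2 \in bad)%:R * D%:R ^+ 2 :> R.
  rewrite inE; case: (boolP (_ && _)) => [/andP[h1 h2]|_].
    by rewrite on_line_degree // subrr expr0n mul0r.
  rewrite mul1r; have := on_line_degree_le z.
  have : 0 <= \sum_(l | inc z l) 1 :> R by apply: sumr_ge0.
  move: (\sum_(l | _) _) (D%:R) => x d; nra.
apply: (@le_trans _ _ (32 * r%:R * ((r * (2 * (r * D)))%:R * D%:R ^+ 2))).
  rewrite ler_wpM2l ?mulr_ge0 //; apply: (le_trans (ler_sum _ (fun z _ => key z))).
  rewrite -mulr_suml ler_wpM2r // -natr_sum ler_nat.
  rewrite -(pair_bigA _ (fun x y => (y \in bad : nat))) /= sum_nat_const card_ord.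
  rewrite leq_mul2l; apply/orP; right; apply: leq_trans cbad.
  rewrite -sum1_card [leqRHS]big_mkcond /=; apply: leq_sum => y _.
  by case: (y \in bad).
rewrite mulrA ler_wpM2r // cardsT card_prod !card_ord -!natrM ler_nat /H.
nia.
Qed.

End Grid.

(** * The constants *)

Section Constants.
Variable s : nat.
Hypothesis s_gt0 : (0 < s)%N.

(* A random subset of density [1 / par_b] has [4 * par_k] points per line on
   average; [2 ^- par_e] is the ratio [y0 / N] in [rich], small enough to beat
   the number of [s * par_H]-subsets of such a random set. *)
Definition par_k := (2 ^ 13 * s)%N.
Definition par_e := (162 * s + 1)%N.
Definition par_b := (2 ^ par_e * par_k)%N.
Definition par_r := (2 * par_b * (2 * par_k))%N.
(** [2 ^ (2560 * s)] is the freezing threshold [W], and [2 ^ 14] exceeds the 9216 of the hypothesis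
    [DW]. *)
Definition par_D := (2 ^ 14 * 2 ^ (2560 * s) * par_r * s)%N.
Definition par_B := (64 * par_r ^ 2 * par_D)%N.
Definition par_H := (par_B + par_r * par_D)%N.
(** An eighth of [par_B], which is within the number of forced points that [hitting_not_rich]
    allows. *)
Definition par_j := (8 * par_r ^ 2 * par_D)%N.

Let s_le_exp : (s <= 2 ^ s)%N. Proof. by apply: ltnW; apply: ltn_expl. Qed.
Let k_gt0 : (0 < par_k)%N. Proof. by rewrite muln_gt0 expn_gt0. Qed.
Let b_gt0 : (0 < par_b)%N. Proof. by rewrite muln_gt0 expn_gt0 k_gt0. Qed.
Lemma par_r_gt0 : (0 < par_r)%N. Proof. by rewrite /par_r muln_gt0 !(muln_gt0 2) b_gt0 k_gt0. Qed.
Lemma par_D_gt0 : (0 < par_D)%N. Proof.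
by rewrite /par_D muln_gt0 (muln_gt0 _ par_r) muln_gt0 !expn_gt0 par_r_gt0 s_gt0.
Qed.

Let r_le : (par_r <= 2 ^ (164 * s + 29))%N.
Proof.
rewrite /par_r /par_b /par_k /par_e.
have -> : (164 * s + 29 = (162 * s + 1) + 28 + (s + s))%N by lia.
rewrite (expnD 2 (162 * s + 1 + 28)) (expnD 2 (162 * s + 1)) (expnD 2 s s).
have -> : (2 * (2 ^ (162 * s + 1) * (2 ^ 13 * s)) * (2 * (2 ^ 13 * s)) =
  2 ^ (162 * s + 1) * (2 * 2 ^ 13 * (2 * 2 ^ 13)) * (s * s))%N.
  by move: (2 ^ (162 * s + 1))%N (2 ^ 13)%N => x y; lia.
have -> : (2 * 2 ^ 13 * (2 * 2 ^ 13) = 2 ^ 28)%N by rewrite -!expnS -expnD.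
by rewrite leq_mul2l leq_mul ?orbT.
Qed.

Let D_le : (par_D <= 2 ^ (2725 * s + 43))%N.
Proof.
rewrite /par_D.
have -> : (2725 * s + 43 = 14 + 2560 * s + (164 * s + 29) + s)%N by lia.
rewrite (expnD 2 (14 + 2560 * s + (164 * s + 29)) s) (expnD 2 (14 + 2560 * s)) (expnD 2 14).
by rewrite !leq_mul.
Qed.

(** The left side is at most a power of 2 with exponent [5778 * s + 152], which is below
    [2 ^ 13 * s]. *)
Lemma par_lines : (4 * (par_D * par_B) <= 2 ^ par_k)%N.
Proof.
apply: (@leq_trans (2 ^ (2 + 6 + (164 * s + 29) * 2 + (2725 * s + 43) * 2))).
  rewrite (expnD 2 (2 + 6 + (164 * s + 29) * 2)) (expnD 2 (2 + 6)) (expnD 2 2 6) !expnM /par_B.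
  have -> : (4 * (par_D * (64 * par_r ^ 2 * par_D)) =
    2 ^ 2 * 2 ^ 6 * par_r ^ 2 * par_D ^ 2)%N.
    by move: par_r par_D => x y; lia.
  by rewrite !leq_mul ?leq_exp2r.
rewrite leq_exp2l // /par_k; have -> : (2 ^ 13 = 8 * 1024)%N by [].
by have := s_gt0; lia.
Qed.

Lemma par_H_le : (par_H <= 9 * par_j)%N.
Proof. by rewrite /par_H /par_B /par_j; have := par_r_gt0; nia. Qed.

Lemma par_j_le : (8 * par_r * par_j <= par_r * par_H)%N.
Proof. by rewrite /par_H /par_B /par_j; nia. Qed.

End Constants.

Lemma grid_hitting_not_rich (R : realType) (s : nat) : (0 < s)%N ->
  ~~ rich (2 * par_k s * (2 * par_k s) * par_H s) (s * par_H s) (par_j s)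
    (hitting (@on_line (par_r s) (par_H s) (par_D s) (par_B s))).
Proof.
move=> s0; set r1 := (2 * par_k s * (2 * par_k s))%N.
have r0 := par_r_gt0 s0; have D0 := par_D_gt0 s0.
have rE : par_r s = (2 ^ par_e s * r1)%N.
  by rewrite /par_r /par_b /r1; move: (2 ^ par_e s)%N (par_k s) => x y; lia.
have H0 : (0 < par_H s)%N.
  by rewrite /par_H addn_gt0 (muln_gt0 (par_r s)) r0 D0 orbT.
have cX : #|{: 'I_(par_r s) * 'I_(par_H s)}| = (par_r s * par_H s)%N.
  by rewrite card_prod !card_ord.
have k_ge : (2048 * s <= par_k s)%N.
  by rewrite /par_k leq_mul2r; apply/orP; right.
have s1 : 1 <= s%:R :> R by rewrite ler1n.
(* With [W = 2 ^ (2560 * s)], [ln 2 >= 1 / 2] gives [ln W >= 1280 * s]. *)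
apply: (@hitting_not_rich R _ _ _ (2 ^+ (2560 * s)) (par_D s)%:R s%:R (par_r s)) => //.
- exact: on_line_linear.
- by move=> l; rewrite sumr_const on_line_card.
- exact: on_line_degree_le.
- by rewrite -cardsT; apply: on_line_defect.
- by rewrite cX muln_gt0 r0.
- by rewrite exprn_ege1 // ler1n.
- have h := ln2_ge_half R; rewrite lnXn // -[leRHS]mulr_natl natrM.
  have := ler_wpM2l (_ : 0 <= 2560 * s%:R) h; rewrite mulr_ge0 // => /(_ isT).
  by clear; lra.
- rewrite /par_D; move: (par_r s) => r'; rewrite 3!natrM 2!natrX.
  have h : 9216 <= 2 ^+ 14 :> R by rewrite -natrX ler_nat.
  by do 3 (apply: ler_wpM2r; first by rewrite ?exprn_ge0).
- rewrite ler_nat; apply: leq_trans (leq_pmull _ _).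
    by rewrite /par_H /par_B; move: r0; clear; nia.
  by rewrite /r1 !muln_gt0; move: k_ge s0; clear; lia.
- rewrite cX -natrX -!natrM ler_nat.
  have h : (4352 * s ^ 2 <= r1)%N.
    by have := leq_mul k_ge k_ge; rewrite /r1 expnS expn1; move: (par_k s) => k; clear; nia.
  by move: h; clear; nia.
- by rewrite cX -!natrM ler_nat; clear; nia.
- rewrite cX -!natrM ler_nat.
  have h : (8 * s <= par_r s)%N.
    rewrite rE; apply: leq_trans (leq_pmull _ _); last by rewrite expn_gt0.
    by rewrite /r1; move: k_ge s0; clear; nia.
  by move: h; clear; nia.
- by rewrite cX -!natrM ler_nat par_j_le.
Qed.

(** The first moment argument at density [1 / par_b]: [not_rich_count] bounds the hitting tuples,
    and each of the two failure terms is at most 1/4. *)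
Lemma grid_subset (R : realType) (s : nat) : (0 < s)%N ->
  let inc := @on_line (par_r s) (par_H s) (par_D s) (par_B s) in
  exists P : {set 'I_(par_r s) * 'I_(par_H s)},
  [/\ (#|P| <= 16 * par_H s * par_k s)%N, (par_B s * par_k s <= #|P|)%N,
    (forall l, (par_k s <= #|[pred x in P | inc x l]|)%N) &
    forall S : {set 'I_(par_r s) * 'I_(par_H s)}, S \subset P ->
      (forall l, exists2 x, x \in S & inc x l) -> (s * par_H s <= #|S|)%N].
Proof.
move=> s0 inc.
have hN := grid_hitting_not_rich R s0.
have r0 := par_r_gt0 s0; have D0 := par_D_gt0 s0.
have k0 : (0 < par_k s)%N by rewrite muln_gt0 expn_gt0.
have b0 : (0 < par_b s)%N by rewrite muln_gt0 expn_gt0 k0.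
have H0 : (0 < par_H s)%N.
  by rewrite /par_H addn_gt0 (muln_gt0 (par_r s)) r0 D0 orbT.
have cX : #|{: 'I_(par_r s) * 'I_(par_H s)}| = (par_r s * par_H s)%N.
  by rewrite card_prod !card_ord.
have cL : #|{: 'I_(par_D s) * 'I_(par_B s)}| = (par_D s * par_B s)%N.
  by rewrite card_prod !card_ord.
have bR : 0 < (par_b s)%:R :> R by rewrite ltr0n.
pose lam : R := (2 ^+ par_e s)^-1.
have lam0 : 0 < lam by rewrite invr_gt0 exprn_gt0.
have rE : par_r s = (2 ^ par_e s * (2 * par_k s * (2 * par_k s)))%N.
  by rewrite /par_r /par_b; move: (2 ^ par_e s)%N (par_k s) => x y; lia.
have hlam : (2 * par_k s * (2 * par_k s) * par_H s)%:R <=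
    lam * #|{: 'I_(par_r s) * 'I_(par_H s)}|%:R.
  have -> : #|{: 'I_(par_r s) * 'I_(par_H s)}| =
      (2 ^ par_e s * (2 * par_k s * (2 * par_k s) * par_H s))%N by rewrite cX {1}rE [RHS]mulnA.
  rewrite [X in lam * X]natrM natrX mulrA mulVf ?mul1r //.
  by rewrite gt_eqF // exprn_gt0.
have hM := not_rich_count hlam (ltW lam0) hN.
have cl := @on_line_card (par_r s) (par_D s) (par_B s).
have dl := @on_line_degree_le R (par_r s) (par_D s) (par_B s).
(* Without the power of [lam], the left side is at most [2 ^ (18 * t)] for [t = s * par_H s], by
   [pow_le_fact]. *)
have t1 : (2 * #|{: 'I_(par_r s) * 'I_(par_H s)}|%:R) ^+ (s * par_H s) * lam ^+ (par_j s).+1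
    * (par_b s)%:R^-1 ^+ (s * par_H s) / (s * par_H s)`!%:R <= 1 / 4 :> R.
  rewrite cX; set t := (s * par_H s)%N; set j := par_j s.
  have f0 : 0 < t`!%:R :> R by rewrite ltr0n fact_gt0.
  (* The 162 in [par_e] is [18 * 9], with 9 from [par_H_le]; the extra 2 in the exponent gives the
     1/4. *)
  have e0 : (18 * t + 2 <= par_e s * j.+1)%N.
    by have := par_H_le s0; rewrite /par_e /t /j; move: (par_H s) (par_j s) s0; clear; nia.
  have b0' : 0 < (par_b s)%:R ^+ t :> R by rewrite exprn_gt0.
  have -> : lam ^+ j.+1 = (2 ^+ (par_e s * j.+1))^-1 by rewrite /lam exprVn exprM.
  rewrite exprVn !ler_pdivrMr ?exprn_gt0 //.
  have p4 : 0 < 4 ^+ t :> R by rewrite exprn_gt0.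
  have base : 4 * (2 * (par_r s * par_H s)%:R) = 2 ^+ 18 * (par_b s)%:R * t%:R :> R.
    rewrite -natrX -!natrM; congr (_%:R); rewrite /par_r /par_k /t.
    have -> : (2 ^ 18 = 4 * 2 * 2 * 2 * 2 ^ 13)%N by rewrite -!mulnA -!expnS -(expnD 2 2).
    by move: (2 ^ 13)%N (par_b s) (par_H s) => x y z; lia.
  have h1 : 4 ^+ t * (2 * (par_r s * par_H s)%:R) ^+ t <=
      4 ^+ t * (2 ^+ (18 * t) * (par_b s)%:R ^+ t * t`!%:R) :> R.
    rewrite -exprMn base (exprMn _ (2 ^+ 18 * _)) (exprMn _ (2 ^+ 18)) [in leRHS]exprM.
    rewrite [leRHS]mulrCA ler_pM2l ?mulr_gt0 ?exprn_gt0 //.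
    exact: pow_le_fact.
  move: h1; rewrite ler_pM2l // => h1; apply: (le_trans h1).
  have h2 : 4 * 2 ^+ (18 * t) <= 2 ^+ (par_e s * j.+1) :> R.
    have -> : 4 = 2 ^+ 2 :> R by rewrite expr2; clear; lra.
    by rewrite -exprD addnC ler_weXn2l ?ler1n.
  have c0 : 0 <= (par_b s)%:R ^+ t * t`!%:R :> R by rewrite mulr_ge0 // ltW.
  have := ler_wpM2r c0 h2; move: (2 ^+ _) (2 ^+ _) ((par_b s)%:R ^+ t) (t`!%:R); clear.
  by move=> a b c d; lra.
(* As [par_r = 2 * par_b * (2 * par_k)], the power is at most [2 ^- (2 * par_k)], so it suffices
   that the number of lines is at most [2 ^ par_k / 4]. *)
have t2 : #|{: 'I_(par_D s) * 'I_(par_B s)}|%:R *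
    (2 ^+ par_k s * (1 - (par_b s)%:R^-1 / 2) ^+ par_r s) <= 1 / 4 :> R.
  have bb : (par_b s)%:R^-1 / 2 = (2 * par_b s)%:R^-1 :> R by rewrite natrM invfM mulrC.
  have pE : par_r s = (2 * par_b s * (2 * par_k s))%N by [].
  rewrite bb {1}pE exprM cL.
  have h1 : (1 - (2 * par_b s)%:R^-1) ^+ (2 * par_b s) <= 1 / 2 :> R.
    by apply: one_sub_inv_pow; rewrite muln_gt0.
  have h0 : 0 <= (1 - (2 * par_b s)%:R^-1) ^+ (2 * par_b s) :> R.
    by rewrite exprn_ge0 // subr_ge0 invf_le1 ?ltr0n ?ler1n muln_gt0.
  have h2 : ((1 - (2 * par_b s)%:R^-1) ^+ (2 * par_b s)) ^+ (2 * par_k s)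
      <= (1 / 2) ^+ (2 * par_k s) :> R by rewrite lerXn2r ?nnegrE ?divr_ge0.
  have h3 : 4 * (par_D s * par_B s)%:R <= 2 ^+ par_k s :> R.
    by rewrite -natrX -natrM ler_nat par_lines.
  have x0 : 0 < 2 ^+ par_k s :> R by rewrite exprn_gt0.
  apply: (@le_trans _ _ ((par_D s * par_B s)%:R * (2 ^+ par_k s * (1 / 2) ^+ (2 * par_k s)))).
    by rewrite ler_wpM2l // ler_wpM2l // ltW.
  have -> : 2 ^+ par_k s * (1 / 2) ^+ (2 * par_k s) = (2 ^+ par_k s)^-1 :> R.
    rewrite mul2n -addnn exprD div1r exprVn mulrA mulfV ?mul1r //.
    by rewrite gt_eqF.
  rewrite ler_pdivrMr //; move: h3; clear; lra.
have p01 : 0 < ((par_b s)%:R^-1 : R) <= 1.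
  by rewrite invr_gt0 bR invf_le1 // ler1n.
have X0 : (0 < #|{: 'I_(par_r s) * 'I_(par_H s)}|)%N by rewrite cX muln_gt0 r0.
have dR : 0 < (par_D s)%:R :> R by rewrite ltr0n.
have HB : (par_H s <= 2 * par_B s)%N.
  by rewrite /par_H /par_B; move: r0; move: (par_r s) (par_D s) => x y; clear; nia.
have dt : (par_D s)%:R * (s * par_H s)%:R <=
    #|{: 'I_(par_D s) * 'I_(par_B s)}|%:R * (par_k s)%:R :> R.
  rewrite cL -!natrM ler_nat -mulnA leq_mul2l; apply/orP; right.
  have k2 : (2 * s <= par_k s)%N by rewrite /par_k leq_mul2r; apply/orP; right.
  by apply: leq_trans (leq_mul (leqnn s) HB) _; rewrite mulnCA mulnA mulnC leq_mul2l k2 orbT.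
have sum_lt : forall a b : R, a <= 1 / 4 -> b <= 1 / 4 -> a + b < 3 / 4.
  by clear; move=> a b; lra.
have [P [h1 h2 h3 h4]] := exists_sparse_subset p01 X0 dR cl dl hM (sum_lt _ _ t1 t2) dt.
exists P; split=> //.
  rewrite -(ler_nat R); apply: (le_trans h1).
  rewrite cX mulrCA ler_pdivrMl // -!natrM ler_nat /par_r.
  by move: (par_b s) (par_k s) (par_H s) => x y z; clear; lia.
move: h2; rewrite cL -!natrM ler_nat -mulnA leq_mul2l => /orP[/eqP e|//].
by rewrite e in D0.
Qed.

(** * The points in the plane *)

Definition grid_point (R : realType) (m n : nat) (z : 'I_m * 'I_n) : R * R :=
  ((z.1 : nat)%:R, (z.2 : nat)%:R).

Lemma grid_point_inj (R : realType) (m n : nat) : injective (@grid_point R m n).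
Proof.
move=> [x y] [x' y'] [] /eqP h1 /eqP h2.
by congr pair; apply: val_inj; apply/eqP; rewrite -(eqr_nat R).
Qed.

Definition points (R : realType) (m n : nat) (P : {set 'I_m * 'I_n}) : {fset R * R} :=
  [fset grid_point R z | z in enum P]%fset.

Lemma card_points (R : realType) (m n : nat) (P : {set 'I_m * 'I_n}) :
  #|` points R P| = #|P|.
Proof.
rewrite card_imfset /=; last exact: grid_point_inj.
by rewrite undup_id ?enum_uniq // cardE.
Qed.

Lemma mem_points (R : realType) (m n : nat) (P : {set 'I_m * 'I_n}) z :
  (grid_point R z \in points R P) = (z \in P).
Proof. by rewrite mem_imfset ?mem_enum //; exact: grid_point_inj. Qed.

Lemma grid_point_on_line (R : realType) (r H D B : nat) (z : 'I_r * 'I_H)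
    (l : 'I_D * 'I_B) :
  (l.1 : nat)%:R * (grid_point R z).1 + (-1) * (grid_point R z).2 = - (l.2 : nat)%:R
  <-> on_line z l.
Proof.
rewrite /on_line -(eqr_nat R) natrD natrM /grid_point /=; split.
  by move=> h; apply/eqP; lra.
by move=> /eqP ->; lra.
Qed.

(** With [eps = k / #|P|] the size threshold of a net is exactly [k], so the points of [P] on [l]
    form an edge that the net must meet. *)
Lemma net_hits_line (R : realType) (r H D B k : nat) (P : {set 'I_r * 'I_H})
    (S : {fset R * R}) (l : 'I_D * 'I_B) :
  (0 < k)%N -> (k <= #|[pred z in P | @on_line r H D B z l]|)%N ->
  eps_net (points R P) (line_hypergraph (points R P)) (k%:R / #|P|%:R : R) S ->
  exists2 z, grid_point R z \in S & @on_line r H D B z l.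
Proof.
move=> k0 hk [_ net].
pose Q : {set 'I_r * 'I_H} := [set z in P | @on_line r H D B z l].
have cQ : (k <= #|Q|)%N.
  by apply: leq_trans hk _; apply: subset_leq_card; apply/fintype.subsetP => z; rewrite !inE.
have P0 : (0 < #|P|)%N.
  apply: leq_trans (leq_trans k0 cQ) _; apply: subset_leq_card.
  by apply/fintype.subsetP => z; rewrite inE => /andP[].
have hQ : line_hypergraph (points R P) (points R Q).
  exists [set p : R * R | (l.1 : nat)%:R * p.1 + (-1) * p.2 = - (l.2 : nat)%:R]%classic.
    exists (l.1 : nat)%:R, (-1), (- (l.2 : nat)%:R); split=> //.
    by move=> [_ /eqP]; rewrite oppr_eq0 oner_eq0.
  apply/seteqP; split=> p /=.
    move=> /imfsetP[z /=]; rewrite mem_enum inE => /andP[zP zl] ->.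
    split; first by rewrite mem_points.
    exact/grid_point_on_line.
  move=> [/imfsetP[z /=]]; rewrite mem_enum => zP -> h.
  by rewrite mem_points inE zP; apply/(grid_point_on_line R).
have Q0 : points R Q != fset0.
  by rewrite -cardfs_gt0 card_points; apply: leq_trans cQ.
have := net _ hQ Q0; rewrite !card_points divfK; last by rewrite pnatr_eq0 -lt0n.
rewrite ler_nat => /(_ cQ) /fset0Pn[p]; rewrite inE => /andP[pS /imfsetP[z /=]].
rewrite mem_enum inE => /andP[zP zl] e.
by exists z; rewrite -?e.
Qed.

Theorem theorem1p1 (R : realType) :
  exists2 c : R, 0 < c &
    forall eps0 : R, 0 < eps0 ->
      exists (eps : R) (P : {fset R * R}),
        [/\ 0 < eps, eps < eps0 &
            forall S : {fset R * R},
              eps_net P (line_hypergraph P) eps S ->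
              c / eps * ln (1 / eps) <= #|` S|%:R].
Proof.
(* The last comparison is [16 * par_H * (2 * par_k) = 2 ^ 18 * s * par_H]. *)
exists (2 ^+ 18)^-1; first by rewrite invr_gt0 exprn_gt0.
(* Any [s > 1 / eps0] works, since [eps = par_k / #|P| <= 1 / par_B <= 1 / s]. *)
move=> eps0 e0; pose s := (Num.truncn eps0^-1).+1.
have s0 : (0 < s)%N by [].
have es : eps0^-1 < s%:R by exact: truncnS_gt.
have [P [cP1 cP2 lP hP]] := grid_subset R s0.
have k0 : (0 < par_k s)%N by rewrite muln_gt0 expn_gt0.
have r0 := par_r_gt0 s0; have D0 := par_D_gt0 s0.
have B0 : (s <= par_B s)%N.
  rewrite /par_B; apply: (@leq_trans (par_D s)).
    by rewrite /par_D leq_pmull // muln_gt0 r0 andbT muln_gt0 !expn_gt0.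
  by apply: leq_pmull; rewrite muln_gt0 expn_gt0 r0.
have kR : 0 < (par_k s)%:R :> R by rewrite ltr0n.
have PR : 0 < #|P|%:R :> R.
  by rewrite ltr0n; apply: leq_trans cP2; rewrite muln_gt0 k0 (leq_trans s0 B0).
exists ((par_k s)%:R / #|P|%:R), (points R P); split.
- by rewrite divr_gt0.
- rewrite ltr_pdivrMr // -ltr_pdivrMl // mulrC.
  apply: (@lt_le_trans _ _ ((par_k s)%:R * s%:R)); first by rewrite ltr_pM2l.
  by rewrite -natrM ler_nat; apply: leq_trans cP2; rewrite mulnC leq_mul2r B0 orbT.
move=> S net.
(* The net, pulled back to the grid, hits every line, so [grid_subset] gives it at least
   [s * par_H s] points. *)
pose S' : {set 'I_(par_r s) * 'I_(par_H s)} := [set z | grid_point R z \in S].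
have S'P : S' \subset P.
  apply/fintype.subsetP => z; rewrite inE => zS.
  by have [/fsubsetP/(_ _ zS)] := net; rewrite mem_points.
have S'hits l : exists2 z, z \in S' & on_line (B := par_B s) (D := par_D s) z l.
  by have [z zS zl] := net_hits_line k0 (lP l) net; exists z; rewrite ?inE.
have cS : (#|S'| <= #|` S|)%N.
  rewrite -(card_points R); apply: fsubset_leq_card; apply/fsubsetP => p.
  by move=> /imfsetP[z /=]; rewrite mem_enum inE => zS ->.
apply: (@le_trans _ _ (s * par_H s)%:R); last first.
  by rewrite ler_nat; apply: leq_trans cS; apply: hP.
(* Hence [1 / eps <= 2 ^ (2 * par_k s)] and [ln (1 / eps) <= 2 * par_k s]. *)
have HB : (16 * par_H s <= 2 ^ (2 * par_k s))%N.
  have h1 := par_lines s0.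
  have h2 : (16 * par_H s <= 8 * (4 * (par_D s * par_B s)))%N.
    rewrite /par_H /par_B; move: r0 D0; move: (par_r s) (par_D s) => x y; clear; nia.
  apply: leq_trans h2 _; apply: leq_trans (leq_mul (leqnn 8) h1) _.
  rewrite mul2n -addnn expnD leq_mul2r; apply/orP; right.
  apply: (@leq_trans (2 ^ 3)) => //; rewrite leq_exp2l //.
  rewrite /par_k; apply: leq_trans (leq_pmulr _ s0); by [].
rewrite div1r invf_div.
have q0 : 0 < #|P|%:R / (par_k s)%:R :> R by rewrite divr_gt0.
have q1 : #|P|%:R / (par_k s)%:R <= 16 * (par_H s)%:R :> R.
  by rewrite ler_pdivrMr // -!natrM ler_nat.
have q2 : ln (#|P|%:R / (par_k s)%:R) <= 2 * (par_k s)%:R :> R.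
  have h : #|P|%:R / (par_k s)%:R <= 2 ^+ (2 * par_k s) :> R.
    by apply: (le_trans q1); rewrite -natrX -natrM ler_nat.
  apply: (@le_trans _ _ (ln (2 ^+ (2 * par_k s)))).
    by rewrite ler_ln ?posrE ?exprn_gt0.
  by rewrite lnXn // -[leLHS]mulr_natl -natrM ler_piMr // ln2_le1.
have p18 : 0 < 2 ^+ 18 :> R by rewrite exprn_gt0.
rewrite -mulrA ler_pdivrMl //.
apply: (@le_trans _ _ (16 * (par_H s)%:R * (2 * (par_k s)%:R))).
  apply: (le_trans (ler_wpM2l (ltW q0) q2)).
  by rewrite ler_wpM2r // mulr_ge0.
rewrite -natrX -!natrM ler_nat /par_k.
have -> : (2 ^ 18 = 2 * 2 * 2 * 2 * 2 * 2 ^ 13)%N by rewrite -!mulnA -!expnS.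
by move: (2 ^ 13)%N (par_H s) => x y; clear; lia.
Qed.
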